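(* In the setting described in the context, the robust tracking problem P1, $$\min_{u}\ \max_{w\ \text{feasible}}\ \mathrm{LQTE}(u,y,w),$$ is equivalent to the problem $$\min_{u\in\mathbb{R}^{mT_f},\ \gamma\in\mathbb{R},\ \alpha\ge 0}\ \gamma\quad\text{s.t.}\quad \begin{bmatrix} (\bar R+B_u^\top\bar Q B_u)^{-1} & \begin{bmatrix} u & \mathbf{0}\end{bmatrix} \\ \begin{bmatrix} u^\top \\ \mathbf{0}\end{bmatrix} & Q_g^a(u,\gamma)-\alpha A_w\end{bmatrix}\ge 0,\qquad (\star)$$ where $$Q_g^a(u,\gamma)=Q_g(u,\gamma)+\begin{bmatrix} u^\top(\bar R+B_u^\top\bar Q B_u)u & \mathbf{0} \\ \mathbf{0}&\mathbf{0}\end{bmatrix}.$$ Here equivalence means: for every $u\in\mathbb{R}^{mT_f}$, the worst-case cost $\max_{w\ \text{feasible}}\mathrm{LQTE}(u,y,w)$ equals the infimum of all $\gamma$ for which there is $\alpha\ge 0$ such that $(u,\gamma,\alpha)$ satisfies the matrix inequality in $(\star)$; hence the two problems have the same optimal value and the same optimal input sequences $u$.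
   Context: **System and data.** $\mathcal{G}$ is a controllable and observable discrete-time LTI system $x_{k+1}=Ax_k+Bu_k$, $y_k=Cx_k+Du_k$, with $x_k\in\mathbb{R}^n$, $u_k\in\mathbb{R}^m$, $y_k\in\mathbb{R}^p$. A finite sequence $\{u_k,y_k\}$ is a trajectory of $\mathcal{G}$ if some state sequence makes these equations hold. Finite sequences are identified with the column vectors obtained by stacking them. The lag $\mathbf{l}(\mathcal{G})$ is the smallest $l$ such that $[C^\top,A^\top C^\top,\dots,(A^{l-1})^\top C^\top]^\top$ has full column rank. For a sequence $v$ of length $T$, $\mathcal{H}_L(v)$ is the Hankel matrix with $L$ block rows whose $j$-th column stacks the entries $j,\dots,j+L-1$ of $v$ ($T-L+1$ columns); $v$ is persistently exciting of order $L$ if $\mathcal{H}_L(v)$ has full row rank. $(\bar u,\bar y)$ is a (noiseless, historical) trajectory of $\mathcal{G}$ of length $T_d$, and $$\begin{bmatrix} U_p \\ U_f \end{bmatrix}=\mathcal{H}_{T_{\mathrm{ini}}+T_f}(\bar u),\qquad \begin{bmatrix} Y_p \\ Y_f \end{bmatrix}=\mathcal{H}_{T_{\mathrm{ini}}+T_f}(\bar y),$$ where $U_p,Y_p$ are the first $T_{\mathrm{ini}}$ block rows and $U_f,Y_f$ the last $T_f$ block rows. Standing assumptions: $\bar u$ is persistently exciting of order $T_{\mathrm{ini}}+T_f+n$ and $T_{\mathrm{ini}}\ge\mathbf{l}(\mathcal{G})$. **Recent data and noise.** $u_{\mathrm{ini}}\in\mathbb{R}^{mT_{\mathrm{ini}}}$,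 $y_{\mathrm{ini}}\in\mathbb{R}^{pT_{\mathrm{ini}}}$ are given. $w\in\mathbb{R}^{pT_{\mathrm{ini}}}$ is called feasible if $(u_{\mathrm{ini}},y_{\mathrm{ini}}-w)$ is a trajectory of $\mathcal{G}$ and $$\begin{bmatrix} 1 \\ w \end{bmatrix}^\top\begin{bmatrix}\Phi_{11}&\Phi_{12} \\ \Phi_{12}^\top&\Phi_{22}\end{bmatrix}\begin{bmatrix} 1 \\ w \end{bmatrix}\ge 0,\qquad \Phi_{22}=\Phi_{22}^\top<0 .$$ The measured $y_{\mathrm{ini}}$ is a noiseless output corrupted by a noise satisfying this bound, so at least one feasible $w$ exists. **Cost and P1.** $r=\mathrm{col}(r_0,\dots,r_{T_f-1})\in\mathbb{R}^{pT_f}$ is a reference, $Q\ge0$, $R>0$ symmetric weights, $\bar Q=\mathbf{I}_{T_f}\otimes Q$, $\bar R=\mathbf{I}_{T_f}\otimes R$. For an input $u\in\mathbb{R}^{mT_f}$ and a feasible $w$, $y\in\mathbb{R}^{pT_f}$ is the unique output for which some $g$ satisfies $$\begin{bmatrix} U_p \\ Y_p \\ U_f \\ Y_f \end{bmatrix}g=\begin{bmatrix} u_{\mathrm{ini}} \\ y_{\mathrm{ini}}-w \\ u \\ y \end{bmatrix},$$ and $\mathrm{LQTE}(u,y,w)=\sum_{k=0}^{T_f-1}\big((y_k-r_k)^\top Q(y_k-r_k)+u_k^\top R u_k\big)$. **Matrices.** $M$ is a matrix whose columns form a basis of $\ker(U_p)$; $g_{\mathrm{ini}}^*=U_p^\top(U_pU_p^\top)^{-1}u_{\mathrm{ini}}$;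 $w_0=y_{\mathrm{ini}}-Y_pg_{\mathrm{ini}}^*$. $A_w=\begin{bmatrix}[A_w]_{11}&[A_w]_{12} \\ {[A_w]}_{12}^\top&[A_w]_{22}\end{bmatrix}$ with $[A_w]_{11}=\Phi_{11}+w_0^\top\Phi_{12}^\top+\Phi_{12}w_0+w_0^\top\Phi_{22}w_0$, $[A_w]_{12}=-\Phi_{12}Y_pM-w_0^\top\Phi_{22}Y_pM$, $[A_w]_{22}=M^\top Y_p^\top\Phi_{22}Y_pM$. $P_Y$ is a permutation matrix with $P_YY_p=[Y_{p1}^\top,Y_{p2}^\top]^\top$ such that $\Lambda=[U_p^\top,Y_{p1}^\top,U_f^\top]^\top$ has full row rank and $\mathrm{rank}(\Lambda)=\mathrm{rank}([U_p^\top,Y_p^\top,U_f^\top]^\top)$. With zero blocks conforming to the blocks of $\Lambda$, $$B_{\mathrm{ini}}=Y_f\Big(\mathbf{I}+\Lambda^\top(\Lambda\Lambda^\top)^{-1}\begin{bmatrix}\mathbf{0} \\ \mathbf{0} \\ -U_f\end{bmatrix}\Big),\quad B_u=Y_f\Lambda^\top(\Lambda\Lambda^\top)^{-1}\begin{bmatrix}\mathbf{0} \\ \mathbf{0} \\ \mathbf{I}\end{bmatrix},\quad B_w=B_{\mathrm{ini}}M,\quad y_0=B_{\mathrm{ini}}g_{\mathrm{ini}}^*.$$ $Q_g(u,\gamma)=\begin{bmatrix}[Q_g]_{11}&[Q_g]_{12} \\ {[Q_g]}_{12}^\top&[Q_g]_{22}\end{bmatrix}$ with $[Q_g]_{11}=\gamma-u^\top\bar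 Ru-(B_uu+y_0-r)^\top\bar Q(B_uu+y_0-r)$, $[Q_g]_{12}=-(B_uu+y_0-r)^\top\bar QB_w$, $[Q_g]_{22}=-B_w^\top\bar QB_w$. For symmetric matrices, $\ge 0$ (resp. $<0$) means positive semidefinite (resp. negative definite). *)

(* Defs.v *)
From HB Require Import structures.
From mathcomp Require Import all_boot all_order all_algebra.
From mathcomp Require Import boolp classical_sets reals.
From mathcomp.real_closed Require Export mxtens.

Set Implicit Arguments.
Unset Strict Implicit.
Unset Printing Implicit Defensive.
Import Order.TTheory GRing.Theory Num.Theory.
Local Open Scope classical_set_scope.
Local Open Scope ring_scope.

(* A sequence v_0, ..., v_(T-1) of vectors of size q is the stacked column
   vector of size T * q; coordinate i of v_k has index k * q + i, which is
   [mxtens_index (k, i)], the convention that [tensmx] also uses.  The value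
   of [entry] outside the range k < T is irrelevant. *)
Definition entry (R : pzRingType) (T q : nat) (v : 'cV[R]_(T * q)) (k : nat) :
    'cV[R]_q :=
  \col_i (if insub k is Some k' then v (mxtens_index (k', i)) 0 else 0).

Definition stack (R : pzRingType) (L q c : nat) (F : nat -> 'M[R]_(q, c)) :
    'M[R]_(L * q, c) :=
  \matrix_(i, j) F (mxtens_unindex i).1 (mxtens_unindex i).2 j.

(* The number of columns T - L + 1 is written T.+1 - L, so that there is no
   column when T < L. *)
Definition hankel (R : pzRingType) (T q L : nat) (v : 'cV[R]_(T * q)) :
    'M[R]_(L * q, T.+1 - L) :=
  stack L (fun k => \matrix_(i < q, j < T.+1 - L) entry v (k + j) i 0).

Definition persistently_exciting (R : realType) (T q L : nat)
    (v : 'cV[R]_(T * q)) : Prop :=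
  row_free (hankel L v).

Definition past (R : pzRingType) (L1 L2 q c : nat)
    (H : 'M[R]_((L1 + L2) * q, c)) : 'M[R]_(L1 * q, c) :=
  usubmx (castmx (mulnDl L1 L2 q, erefl c) H).

Definition future (R : pzRingType) (L1 L2 q c : nat)
    (H : 'M[R]_((L1 + L2) * q, c)) : 'M[R]_(L2 * q, c) :=
  dsubmx (castmx (mulnDl L1 L2 q, erefl c) H).

Record lti (R : realType) (n m p : nat) := Lti {
  sysA : 'M[R]_n;
  sysB : 'M[R]_(n, m);
  sysC : 'M[R]_(p, n);
  sysD : 'M[R]_(p, m) }.

Section Systems.
Context {R : realType} {n m p : nat}.
Implicit Type G : lti R n m p.

Definition step G (x : 'cV[R]_n) (u : 'cV[R]_m) : 'cV[R]_n :=
  sysA G *m x + sysB G *m u.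

Definition readout G (x : 'cV[R]_n) (u : 'cV[R]_m) : 'cV[R]_p :=
  sysC G *m x + sysD G *m u.

Definition trajectory G (T : nat) (u : 'cV[R]_(T * m)) (y : 'cV[R]_(T * p)) :
    Prop :=
  exists x : nat -> 'cV[R]_n, forall k, (k < T)%N ->
    x k.+1 = step G (x k) (entry u k) /\
    entry y k = readout G (x k) (entry u k).

Definition controllable G : Prop :=
  forall x0 x1 : 'cV[R]_n,
  exists (T : nat) (u : nat -> 'cV[R]_m) (x : nat -> 'cV[R]_n),
    [/\ x 0%N = x0, forall k, (k < T)%N -> x k.+1 = step G (x k) (u k)
      & x T = x1].

Definition observable G : Prop :=
  exists T : nat,
  forall (u : nat -> 'cV[R]_m) (x x' : nat -> 'cV[R]_n),
    (forall k, (k < T)%N -> x k.+1 = step G (x k) (u k)) ->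
    (forall k, (k < T)%N -> x' k.+1 = step G (x' k) (u k)) ->
    (forall k, (k < T)%N -> readout G (x k) (u k) = readout G (x' k) (u k)) ->
    x 0%N = x' 0%N.

Definition obs_mx G (l : nat) : 'M[R]_(l * p, n) :=
  stack l (fun k => sysC G *m sysA G ^+ k).

Definition is_lag G (l : nat) : Prop :=
  row_full (obs_mx G l) /\
  forall l' : nat, row_full (obs_mx G l') -> (l <= l')%N.

End Systems.

Section Matrices.
Context {R : realType}.

Definition qform (k : nat) (S : 'M[R]_k) (x : 'cV[R]_k) : R :=
  (x^T *m S *m x) 0 0.

Definition psd (k : nat) (S : 'M[R]_k) : Prop :=
  S^T = S /\ forall x : 'cV[R]_k, 0 <= qform S x.

Definition posdef (k : nat) (S : 'M[R]_k) : Prop :=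
  S^T = S /\ forall x : 'cV[R]_k, x != 0 -> 0 < qform S x.

Definition negdef (k : nat) (S : 'M[R]_k) : Prop :=
  S^T = S /\ forall x : 'cV[R]_k, x != 0 -> qform S x < 0.

(* [kermx] is a kernel for row vectors, hence the transpositions. *)
Definition ker_basis (a b d : nat) (U : 'M[R]_(a, b)) (M : 'M[R]_(b, d)) :
    Prop :=
  row_free M^T /\ (M^T :=: kermx U^T)%MS.

(* Lambda^T (Lambda Lambda^T)^-1; the inverse is genuine when Lambda has full
   row rank. *)
Definition rpinv (a b : nat) (L : 'M[R]_(a, b)) : 'M[R]_(b, a) :=
  L^T *m invmx (L *m L^T).

Definition B_ini (a b c e N : nat) (Up : 'M[R]_(a, N)) (Yp1 : 'M[R]_(b, N))
    (Uf : 'M[R]_(c, N)) (Yf : 'M[R]_(e, N)) : 'M[R]_(e, N) :=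
  Yf *m (1%:M + rpinv (col_mx Up (col_mx Yp1 Uf))
                  *m col_mx 0 (col_mx 0 (- Uf))).

Definition B_u (a b c e N : nat) (Up : 'M[R]_(a, N)) (Yp1 : 'M[R]_(b, N))
    (Uf : 'M[R]_(c, N)) (Yf : 'M[R]_(e, N)) : 'M[R]_(e, c) :=
  Yf *m rpinv (col_mx Up (col_mx Yp1 Uf)) *m col_mx 0 (col_mx 0 1%:M).

Definition A_w (a d : nat) (Phi11 : 'M[R]_1) (Phi12 : 'rV[R]_a)
    (Phi22 : 'M[R]_a) (w0 : 'cV[R]_a) (YpM : 'M[R]_(a, d)) : 'M[R]_(1 + d) :=
  let A12 := - (Phi12 *m YpM) - w0^T *m Phi22 *m YpM in
  block_mx
    (Phi11 + w0^T *m Phi12^T + Phi12 *m w0 + w0^T *m Phi22 *m w0) A12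
    A12^T (YpM^T *m Phi22 *m YpM).

Definition Q_g (c e d : nat) (Qbar : 'M[R]_e) (Rbar : 'M[R]_c)
    (Bu : 'M[R]_(e, c)) (Bw : 'M[R]_(e, d)) (y0 r : 'cV[R]_e)
    (u : 'cV[R]_c) (gamma : R) : 'M[R]_(1 + d) :=
  let z := Bu *m u + y0 - r in
  let Q12 := - (z^T *m Qbar *m Bw) in
  block_mx
    (gamma%:M - u^T *m Rbar *m u - z^T *m Qbar *m z) Q12
    Q12^T (- (Bw^T *m Qbar *m Bw)).

(* The left-hand side of the matrix inequality. *)
Definition lmi_mx (c e d : nat) (Qbar : 'M[R]_e) (Rbar : 'M[R]_c)
    (Bu : 'M[R]_(e, c)) (Bw : 'M[R]_(e, d)) (y0 r : 'cV[R]_e)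
    (Aw : 'M[R]_(1 + d)) (u : 'cV[R]_c) (gamma alpha : R) :
    'M[R]_(c + (1 + d)) :=
  let W := Rbar + Bu^T *m Qbar *m Bu in
  let Qga := Q_g Qbar Rbar Bu Bw y0 r u gamma
             + block_mx (u^T *m W *m u) 0 0 0 in
  block_mx
    (invmx W) (row_mx u 0)
    (col_mx u^T 0) (Qga - alpha *: Aw).

End Matrices.

Definition feasible (R : realType) (n m p Ti : nat) (G : lti R n m p)
    (uini : 'cV[R]_(Ti * m)) (yini : 'cV[R]_(Ti * p)) (Phi11 : 'M[R]_1)
    (Phi12 : 'rV[R]_(Ti * p)) (Phi22 : 'M[R]_(Ti * p)) (w : 'cV[R]_(Ti * p)) :
    Prop :=
  trajectory G uini (yini - w) /\
  0 <= qform (block_mx Phi11 Phi12 Phi12^T Phi22) (col_mx 1%:M w).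

(* Definite description: the value is the element of a set that is a singleton
   for feasible w, and 0 if the set is empty. *)
Definition predicted_output (R : realType) (a b c e N : nat)
    (Up : 'M[R]_(a, N)) (Yp : 'M[R]_(b, N)) (Uf : 'M[R]_(c, N))
    (Yf : 'M[R]_(e, N)) (uini : 'cV[R]_a) (yini : 'cV[R]_b) (u : 'cV[R]_c)
    (w : 'cV[R]_b) : 'cV[R]_e :=
  xget 0 [set y | exists g : 'cV[R]_N,
    col_mx Up (col_mx Yp (col_mx Uf Yf)) *m g
    = col_mx uini (col_mx (yini - w) (col_mx u y))].

Definition lqte (R : realType) (m p Tf : nat) (Q : 'M[R]_p) (Ru : 'M[R]_m)
    (r : 'cV[R]_(Tf * p)) (u : 'cV[R]_(Tf * m)) (y : 'cV[R]_(Tf * p)) : R :=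
  \sum_(k < Tf) (qform Q (entry y k - entry r k) + qform Ru (entry u k)).

Definition is_max (R : realType) (S : set R) (v : R) : Prop :=
  S v /\ ubound S v.

(* Main.v *)
Require Import Defs.
From HB Require Import structures.
From mathcomp Require Import all_boot all_order all_algebra.
From mathcomp Require Import boolp classical_sets reals.
From mathcomp Require Import topology normedtype derive.
From mathcomp Require Import zify ring lra.
Set Implicit Arguments.
Unset Strict Implicit.
Unset Printing Implicit Defensive.
Import Order.TTheory GRing.Theory Num.Theory.
Local Open Scope classical_set_scope.
Local Open Scope ring_scope.

(** By Willems' fundamental lemma the feasible noises are the [w0 - Yp M x] whose
quadratic constraint holds, and the output predicted for [u] and such a noise
is [B_u u + y0 + B_w x]. The cost and the constraint thus become the quadratic
forms [gamma - Q_g] and [A_w] at [(1, x)], and a Schur complement turns the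
matrix inequality into [Q_g - alpha A_w >= 0]. Every such [gamma] bounds the
cost on the feasible set. Conversely, any [gamma] above the maximal cost admits a
multiplier: by the S-lemma when the constraint can be strict; otherwise the
constraint is [- P (x - x0) >= 0] with [P] positive semidefinite, and [P]
dominates the variable part of the cost because [B_w x] depends on [Yp M x]
only. In the second case the infimum need not be attained. *)

(** * Stacked sequences and Hankel matrices *)

Section StackedSequences.
Context {R : pzRingType}.

Lemma entry_stack (L q : nat) (F : nat -> 'cV[R]_q) (k : nat) :
  (k < L)%N -> entry (stack L F) k = F k.
Proof.
move=> kL; apply/colP => i; rewrite !mxE insubT /= !mxE mxtens_indexK /=.
by congr (F k i _); apply: val_inj; rewrite ord1.
Qed.

Lemma entry_out (T q : nat) (v : 'cV[R]_(T * q)) (k : nat) :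
  (T <= k)%N -> entry v k = 0.
Proof. by move=> Tk; apply/colP => i; rewrite !mxE insubF // ltnNge Tk. Qed.

Lemma entry0 (T q k : nat) : entry (0 : 'cV[R]_(T * q)) k = 0.
Proof. by apply/colP => i; rewrite !mxE; case: insub => [k'|]; rewrite ?mxE. Qed.

Lemma stack_entry (T q : nat) (v : 'cV[R]_(T * q)) : stack T (entry v) = v.
Proof.
apply/colP => i; case: (mxtens_indexP i) => k j.
rewrite !mxE mxtens_indexK /= insubT //= => kT.
by congr (v (mxtens_index (_, _)) _); apply: val_inj.
Qed.

Lemma eq_stack (L q c : nat) (F F' : nat -> 'M[R]_(q, c)) :
  (forall k, (k < L)%N -> F k = F' k) -> stack L F = stack L F'.
Proof. by move=> eqF; apply/matrixP => i j; rewrite !mxE eqF. Qed.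

Lemma eq_entry (T q : nat) (v v' : 'cV[R]_(T * q)) :
  (forall k, (k < T)%N -> entry v k = entry v' k) -> v = v'.
Proof. by move=> eqv; rewrite -(stack_entry v) -(stack_entry v') (eq_stack eqv). Qed.

Lemma entryB (T q : nat) (v v' : 'cV[R]_(T * q)) (k : nat) :
  entry (v - v') k = entry v k - entry v' k.
Proof.
by apply/colP => i; rewrite !mxE; case: insub => [k'|]; rewrite ?mxE ?subr0.
Qed.

Lemma stackM (L q c e : nat) (F : nat -> 'M[R]_(q, c)) (g : 'M[R]_(c, e)) :
  stack L F *m g = stack L (fun k => F k *m g).
Proof. by apply/matrixP => i j; rewrite !mxE; apply: eq_bigr => k _; rewrite !mxE. Qed.

Lemma mul_row_stack (L q c : nat) (x : 'cV[R]_(L * q)) (F : nat -> 'M[R]_(q, c)) :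
  x^T *m stack L F = \sum_(k < L) (entry x k)^T *m F k.
Proof.
apply/rowP => j; rewrite summxE !mxE.
rewrite (reindex (fun kl : 'I_L * 'I_q => mxtens_index kl)) /=; last first.
  exists (fun i => mxtens_unindex i) => i _; rewrite ?mxtens_indexK ?mxtens_unindexK //.
transitivity (\sum_(k < L) \sum_(l < q)
    x^T 0 (mxtens_index (k, l)) * stack L F (mxtens_index (k, l)) j).
  by rewrite pair_bigA; apply: eq_bigr => -[].
apply: eq_bigr => k _; rewrite !mxE; apply: eq_bigr => l _.
rewrite !mxE mxtens_indexK /= insubT //= => kL.
by congr (x (mxtens_index (_, _)) _ * _); apply: val_inj.
Qed.

Lemma past_stack (L1 L2 q c : nat) (F : nat -> 'M[R]_(q, c)) :
  past (stack (L1 + L2) F) = stack L1 F.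
Proof.
apply/matrixP => i j; case: (mxtens_indexP i) => k l.
rewrite mxE castmxE !mxE /= cast_ord_id.
by congr (F _ _ _); apply: val_inj.
Qed.

Lemma future_stack (L1 L2 q c : nat) (F : nat -> 'M[R]_(q, c)) :
  future (stack (L1 + L2) F) = stack L2 (fun k => F (L1 + k)%N).
Proof.
apply/matrixP => i j; case: (mxtens_indexP i) => k l.
rewrite mxE castmxE !mxE /= cast_ord_id.
have lq := ltn_ord l.
have q0 : (0 < q)%N by apply: leq_ltn_trans lq.
congr (F _ _ _); first by rewrite addnA -mulnDl divnMDl // divnMDl // (divn_small lq) !addn0.
by apply: val_inj => /=; rewrite addnA -mulnDl !modnMDl.
Qed.

(** Block row [k] of a Hankel matrix, with a free width [N]: the past and future blocks share the
    width of the full matrix. *)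
Definition window (T q N : nat) (v : 'cV[R]_(T * q)) (k : nat) : 'M[R]_(q, N) :=
  \matrix_(i, j) entry v (k + j) i 0.

Lemma past_hankel (T q L1 L2 : nat) (v : 'cV[R]_(T * q)) :
  past (hankel (L1 + L2) v) = stack L1 (window (T.+1 - (L1 + L2)) v).
Proof. exact: past_stack. Qed.

Lemma future_hankel (T q L1 L2 : nat) (v : 'cV[R]_(T * q)) :
  future (hankel (L1 + L2) v)
  = stack L2 (fun k => window (T.+1 - (L1 + L2)) v (L1 + k)).
Proof. exact: future_stack. Qed.

End StackedSequences.

(** * Willems' fundamental lemma: the rank condition *)

(* The relation [e x_j + sum_k z_k u_(j+k) = 0] shifted s times along the
   system: the new coefficients are [e A^(s-1-t) B] for t < s, followed by z. *)
Definition shifted_coef (R : pzRingType) (n m : nat) (A : 'M[R]_n)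
    (B : 'M[R]_(n, m)) (e : 'rV[R]_n) (z : nat -> 'rV[R]_m) (s t : nat) : 'rV[R]_m :=
  if (t < s)%N then e *m A ^+ (s.-1 - t) *m B else z (t - s)%N.

(** Cayley-Hamilton for the characteristic polynomial; size 0 is apart because the matrix ring is
    trivial there. The leading coefficient 1 makes the eliminations in [fundamental_row_free]
    triangular. *)
Lemma monic_annihilator (R : comNzRingType) (n : nat) (A : 'M[R]_n) :
  exists a : nat -> R, a n = 1 /\ \sum_(s < n.+1) a s *: A ^+ s = 0.
Proof.
case: n A => [|n] A; first by exists (fun=> 1); split=> //; apply/flatmx0.
exists (fun s => (char_poly A)`_s); split.
  by have /monicP := char_poly_monic A; rewrite /lead_coef size_char_poly.
rewrite -[RHS](Cayley_Hamilton A) /horner_mx /horner_morph horner_coef.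
rewrite size_map_poly_id0; last first.
  by rewrite (monicP (char_poly_monic A)) -scalemx1 scale1r oner_eq0.
rewrite size_char_poly; apply: eq_bigr => s _.
by rewrite coef_map -mul_scalar_mx.
Qed.

Section FundamentalLemma.
Context {R : realType} {n m p : nat} (G : lti R n m p).
Local Notation A := (sysA G).
Local Notation B := (sysB G).

(** Each functional [e A^i] vanishes along every run started at 0, and by controllability such runs
    reach every state. *)
Lemma controllable_left_kernel (e : 'rV[R]_n) : controllable G ->
  (forall k, e *m A ^+ k *m B = 0) -> e = 0.
Proof.
move=> ctrl eAB; suff ex x1 : e *m x1 = 0 :> 'M_1.
  apply/rowP => j; have /matrixP/(_ 0 0) := ex (delta_mx j 0).
  by rewrite -colE !mxE.
have [T [u [x [x0 stepx <-]]]] := ctrl 0 x1.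
suff {x1} H k : (k <= T)%N -> forall i, e *m A ^+ i *m x k = 0.
  by have := H T (leqnn T) 0%N; rewrite expr0 mulmx1.
elim: k => [_ i|k IH kT i]; first by rewrite x0 mulmx0.
rewrite stepx // /step mulmxDr !mulmxA eAB mul0mx addr0.
by rewrite -(mulmxA e) -[_ *m A]/(A ^+ i * A) -exprSr IH // ltnW.
Qed.


(** Induction on [s]: in the relation at [j + 1], substituting the state equation for [x j.+1] turns
    [e A^s x j.+1] into [e A^(s+1) x j] plus the new first coefficient [e A^s B] on [u j]. *)
Lemma shifted_relation (T L : nat) (x : nat -> 'cV[R]_n) (u : nat -> 'cV[R]_m)
    (e : 'rV[R]_n) (z : nat -> 'rV[R]_m) :
  (forall j, (j < T)%N -> x j.+1 = step G (x j) (u j)) ->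
  (forall j, (j + L <= T)%N ->
     e *m x j + \sum_(k < L) z k *m u (j + k)%N = 0) ->
  forall s j, (j + (s + L) <= T)%N ->
    e *m A ^+ s *m x j
    + \sum_(t < s + L) shifted_coef A B e z s t *m u (j + t)%N = 0.
Proof.
move=> stepx rel; elim=> [|s IH] j jT.
  by rewrite expr0 mulmx1 -[RHS](rel j jT); congr (_ + _); apply: eq_bigr => k _;
     rewrite /shifted_coef subn0.
rewrite addSn big_ord_recl /= addn0 {1}/shifted_coef /= subn0.
rewrite -[RHS](IH j.+1) ?addSnnS // stepx; last first.
  by rewrite (leq_trans _ jT) // addSn addnS ltnS leq_addr.
rewrite /step mulmxDr !mulmxA addrA exprSr -(mulmxA e (A ^+ s) A).
congr (_ + _); apply: eq_bigr => t _.
by rewrite /shifted_coef /= /bump add1n ltnS subSS addSnnS subnS predn_sub.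
Qed.

(** The coefficients, stacked into a row, lie in the left kernel of a Hankel matrix of full row
    rank. *)
Lemma persistently_exciting_eq0 (T L : nat) (u : 'cV[R]_(T * m))
    (c : nat -> 'rV[R]_m) :
  persistently_exciting L u ->
  (forall j, (j < T.+1 - L)%N -> \sum_(t < L) c t *m entry u (j + t) = 0) ->
  forall t, (t < L)%N -> c t = 0.
Proof.
move=> pe rel t tL.
have : (stack L (fun t => (c t)^T))^T *m hankel L u = 0.
  rewrite mul_row_stack; apply/rowP => j; rewrite [RHS]mxE.
  have /matrixP/(_ 0 0) := rel j (ltn_ord j); rewrite [RHS]mxE => <-.
  rewrite !summxE; apply: eq_bigr => k _; rewrite entry_stack // trmxK !mxE.
  by apply: eq_bigr => i _; rewrite !mxE addnC.
move/eqP; rewrite mulmx_free_eq0 // trmx_eq0 => /eqP/(congr1 (fun v => entry v t)).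
by rewrite entry_stack // entry0 => ct0; apply: trmx_inj; rewrite ct0 trmx0.
Qed.

(** A left-kernel vector is a linear relation between [x j] and the inputs [u j, ..., u (j+L-1)].
    Eliminating the state costs [n] more shifts, whence the order [L + n]; excitation then kills the
    input coefficients and controllability the state coefficient. *)
Lemma fundamental_row_free (T L : nat) (u : 'cV[R]_(T * m)) (x : nat -> 'cV[R]_n) :
  controllable G -> persistently_exciting (L + n) u ->
  (forall j, (j < T)%N -> x j.+1 = step G (x j) (entry u j)) ->
  row_free (col_mx (hankel L u) (\matrix_(i < n, j < T.+1 - L) x j i 0)).
Proof.
move=> ctrl pe stepx; apply: inj_row_free => v.
rewrite -[v]hsubmxK mul_row_col; set e := rsubmx v; set z0 := lsubmx v => rel0.
pose z k : 'rV[R]_m := (entry z0^T k)^T.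
(* The default value 0 of [entry] makes [z] vanish from [L] on. *)
have z_out k : (L <= k)%N -> z k = 0 by move=> Lk; rewrite /z entry_out ?trmx0.
have rel j : (j + L <= T)%N ->
    e *m x j + \sum_(k < L) z k *m entry u (j + k) = 0.
  move=> jT; have jN : (j < T.+1 - L)%N by lia.
  apply/matrixP => a b; rewrite !ord1 [RHS]mxE.
  move/matrixP/(_ 0 (Ordinal jN)): rel0; rewrite [RHS]mxE => <-.
  rewrite addrC mxE [RHS]mxE; congr (_ + _); last first.
    by rewrite !mxE; apply: eq_bigr => i _; rewrite !mxE.
  rewrite -[z0]trmxK mul_row_stack !summxE; apply: eq_bigr => k _.
  by rewrite !mxE; apply: eq_bigr => i _; rewrite !mxE addnC.
have [a [an1 aA]] := monic_annihilator A.
(* Weighting the shifted relations by the annihilating polynomial of A removes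
   the state and leaves a relation between inputs only. *)
pose c t := \sum_(s < n.+1) a s *: shifted_coef A B e z s t.
have c0 t : c t = 0.
  case: (ltnP t (L + n)) => [tLn|Lnt]; last first.
    rewrite /c big1 // => s _; rewrite /shifted_coef.
    have := ltn_ord s; rewrite ltnS => sn.
    by rewrite ifN ?z_out ?scaler0 //; lia.
  apply: (persistently_exciting_eq0 pe) (tLn) => j jN.
  have jT : (j + (n + L) <= T)%N by lia.
  have rel_s (s : 'I_n.+1) : e *m A ^+ s *m x j
      + \sum_(t < L + n) shifted_coef A B e z s t *m entry u (j + t) = 0.
    have sn : (s <= n)%N by rewrite -ltnS.
    rewrite -[RHS](@shifted_relation T L x (entry u) e z stepx rel s j); last by lia.
    (* The relation shifted [s] times has length [s + L]; zero values of [z] pad it to the common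
       length [L + n]. *)
    congr (_ + _); have sLn : (s + L <= L + n)%N by lia.
    rewrite (big_ord_widen _
      (fun t => shifted_coef A B e z s t *m entry u (j + t)%N) sLn).
    rewrite [RHS]big_mkcond; apply: eq_bigr => t' _; case: ltnP => // sLt.
    by rewrite /shifted_coef ifN ?z_out ?mul0mx //; lia.
  have : \sum_(s < n.+1) a s *: (e *m A ^+ s *m x j
      + \sum_(t < L + n) shifted_coef A B e z s t *m entry u (j + t)) = 0.
    by rewrite big1 // => s _; rewrite rel_s scaler0.
  under eq_bigr do rewrite scalerDr scalemxAl scalemxAr.
  rewrite big_split /= -mulmx_suml -mulmx_sumr aA mulmx0 mul0mx add0r => sum0.
  rewrite -[RHS]sum0; under [RHS]eq_bigr do rewrite scaler_sumr.
  rewrite [RHS]exchange_big /=; apply: eq_bigr => k _.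
  by rewrite mulmx_suml; apply: eq_bigr => s _; rewrite scalemxAl.
(* [c (n + k)] is [z k] plus multiples of later values of [z], so the induction runs downwards from
   [L]. *)
have zz0 k : z k = 0.
  move: {2}(L - k)%N (leqnn (L - k)) => b; elim: b k => [|b IH] k.
    by rewrite leqn0 subn_eq0; apply: z_out.
  move=> Lkb; have := c0 (n + k)%N; rewrite /c big_ord_recr /= an1 scale1r.
  rewrite big1 ?add0r => [|s _].
    by rewrite /shifted_coef ltnNge leq_addr /= addKn.
  rewrite /shifted_coef ltnNge (leq_trans (ltnW (ltn_ord s)) (leq_addr _ _)) /=.
  by rewrite IH ?scaler0 //; have := ltn_ord s; lia.
(* For [k < n], [c (n - 1 - k)] is [e A^k B] plus multiples of the same expression at lower powers
   and of values of [z]. For [k >= n], Cayley-Hamilton reduces to lower powers. *)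
have eAB k : e *m A ^+ k *m B = 0.
  elim/ltn_ind: k => k IH; case: (ltnP k n) => [kn|nk]; last first.
    move: aA => /(congr1 (mulmx (e *m A ^+ (k - n)))) /(congr1 (mulmx^~ B)) /=.
    rewrite mulmx0 mul0mx mulmx_sumr mulmx_suml big_ord_recr /= an1 scale1r.
    rewrite big1 ?add0r => [|s _].
      by rewrite -(mulmxA e) -[_ *m A ^+ n]exprD subnK.
    rewrite -scalemxAr -scalemxAl -(mulmxA e) -[_ *m A ^+ s]exprD IH ?scaler0 //.
    by rewrite -ltn_subRL subKn.
  have := c0 (n.-1 - k)%N; rewrite /c big_ord_recr /= an1 scale1r.
  have n0 : (0 < n)%N by apply: leq_ltn_trans kn.
  have kn1 : (k <= n.-1)%N by rewrite -ltnS prednK.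
  rewrite big1 ?add0r => [|s _].
    by rewrite /shifted_coef ifT ?subKn //; lia.
  rewrite /shifted_coef; case: ltnP => nks; last by rewrite zz0 scaler0.
  by rewrite IH ?scaler0 //; have := ltn_ord s; lia.
have e0 : e = 0 by apply: controllable_left_kernel ctrl eAB.
suff -> : z0 = 0 by rewrite e0 row_mx0.
apply: trmx_inj; rewrite trmx0; apply: eq_entry => k _.
by apply: trmx_inj; rewrite -/(z k) zz0 entry0 trmx0.
Qed.

End FundamentalLemma.

(** * Trajectories as images of the Hankel matrices *)

Section HankelTrajectories.
Context {R : realType} {n m p : nat} (G : lti R n m p).
Context {Td Ti Tf : nat} (ud : 'cV[R]_(Td * m)) (yd : 'cV[R]_(Td * p)).
Local Notation L := (Ti + Tf)%N.
Local Notation N := (Td.+1 - L)%N.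
Local Notation Up := (past (hankel L ud)).
Local Notation Uf := (future (hankel L ud)).
Local Notation Yp := (past (hankel L yd)).
Local Notation Yf := (future (hankel L yd)).

Hypothesis trajd : trajectory G ud yd.

(** Column [j] of [X k] is the state at time [k + j], so the system equations hold for whole block
    rows and pass to every combination [g] of columns. *)
Lemma window_states : controllable G -> persistently_exciting (L + n) ud ->
  exists X : nat -> 'M[R]_(n, N),
    [/\ forall k, (k < L)%N ->
          X k.+1 = sysA G *m X k + sysB G *m window N ud k,
        forall k, (k < L)%N ->
          window N yd k = sysC G *m X k + sysD G *m window N ud k
      & row_free (col_mx (hankel L ud) (X 0%N))].
Proof.
move=> ctrl pe; have [x xP] := trajd.
exists (fun k => \matrix_(i, j) x (k + j)%N i 0); split.
- move=> k kL; apply/matrixP => i j; have jN := ltn_ord j.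
  have [xS _] := xP (k + j)%N ltac:(lia).
  rewrite mxE addSn xS !mxE; congr (_ + _); apply: eq_bigr => l _; rewrite !mxE //.
- move=> k kL; apply/matrixP => i j; have jN := ltn_ord j.
  have [_ yE] := xP (k + j)%N ltac:(lia).
  rewrite mxE yE !mxE; congr (_ + _); apply: eq_bigr => l _; rewrite !mxE //.
- by apply: (@fundamental_row_free _ _ _ _ G _ _ _ x) => // j /xP[].
Qed.

Lemma entry_stackM (T q : nat) (F : nat -> 'M[R]_(q, N)) (g : 'cV[R]_N) k :
  (k < T)%N -> entry (stack T F *m g) k = F k *m g.
Proof. by move=> kT; rewrite stackM entry_stack. Qed.

Lemma hankel_image_trajectory (g : 'cV[R]_N) :
  controllable G -> persistently_exciting (L + n) ud ->
  trajectory G (Up *m g) (Yp *m g).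
Proof.
move=> ctrl pe; have [X [XS YE _]] := window_states ctrl pe.
rewrite !past_hankel; exists (fun k => X k *m g) => k kT.
have kL : (k < L)%N by lia.
by rewrite !entry_stackM // XS // YE // !mulmxDl -!mulmxA.
Qed.

(** A trajectory is determined by its initial state and inputs, and the rank condition gives a [g]
    matching that state, the past input and an arbitrary future input at once. *)
Lemma trajectory_hankel_image (uini : 'cV[R]_(Ti * m)) (y : 'cV[R]_(Ti * p))
    (u : 'cV[R]_(Tf * m)) :
  controllable G -> persistently_exciting (L + n) ud ->
  trajectory G uini y ->
  exists g, [/\ Up *m g = uini, Yp *m g = y & Uf *m g = u].
Proof.
move=> ctrl pe [x xP]; have [X [XS YE /row_freeP[K XK]]] := window_states ctrl pe.
pose a := stack L (fun k => if (k < Ti)%N then entry uini k else entry u (k - Ti)).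
pose g := K *m col_mx a (x 0%N); exists g.
have /eq_col_mx[ug xg] : col_mx (hankel L ud *m g) (X 0%N *m g) = col_mx a (x 0%N).
  by rewrite -mul_col_mx mulmxA XK mul1mx.
have winu k : (k < L)%N ->
    window N ud k *m g = if (k < Ti)%N then entry uini k else entry u (k - Ti).
  by move=> kL; rewrite -(entry_stackM _ _ kL) -/(hankel L ud) ug entry_stack.
have upg k : (k < Ti)%N -> window N ud k *m g = entry uini k.
  by move=> kT; rewrite winu ?kT //; lia.
have Xx k : (k <= Ti)%N -> X k *m g = x k.
  elim: k => // k IH kT; have [-> _] := xP k kT.
  by rewrite XS ?mulmxDl -?mulmxA ?IH ?upg //; lia.
split; rewrite ?past_hankel ?future_hankel; apply: eq_entry => k kT.
- by rewrite entry_stackM // upg.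
- rewrite entry_stackM // YE; last by lia.
  by have [_ ->] := xP k kT; rewrite mulmxDl -!mulmxA upg // Xx // ltnW.
- by rewrite entry_stackM // winu ?ltn_add2l // ifN ?addKn //; lia.
Qed.

(** Zero inputs and zero outputs over at least [l] steps force the initial state to 0 by full column
    rank of the observability matrix. This makes the predicted output unique. *)
Lemma future_output_eq0 (l : nat) (g : 'cV[R]_N) :
  controllable G -> persistently_exciting (L + n) ud ->
  is_lag G l -> (l <= Ti)%N ->
  Up *m g = 0 -> Yp *m g = 0 -> Uf *m g = 0 -> Yf *m g = 0.
Proof.
move=> ctrl pe [full_l _] lTi; have [X [XS YE _]] := window_states ctrl pe.
rewrite !past_hankel !future_hankel => up0 yp0 uf0.
have u0 k : (k < L)%N -> window N ud k *m g = 0.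
  move=> kL; case: (ltnP k Ti) => kT; first by rewrite -(entry_stackM _ _ kT) up0 entry0.
  rewrite -{1}(subnKC kT) -(entry_stackM (fun k => window N ud (Ti + k)%N) g (T := Tf)).
    by rewrite uf0 entry0.
  by lia.
have XA k : (k <= L)%N -> X k *m g = sysA G ^+ k *m (X 0%N *m g).
  elim: k => [|k IH] kL; first by rewrite expr0 mul1mx.
  by rewrite XS // mulmxDl -!mulmxA u0 // mulmx0 addr0 IH ?(ltnW kL) // exprS mulmxA.
have X0 : X 0%N *m g = 0.
  have [K KO] := row_fullP full_l.
  rewrite -[LHS]mul1mx -KO -mulmxA /obs_mx stackM.
  rewrite (_ : stack _ _ = 0) ?mulmx0 //; apply: eq_entry => k kl.
  have kT : (k < Ti)%N by lia.
  have kL : (k < L)%N by lia.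
  rewrite entry_stack // entry0 -mulmxA -XA ?(ltnW kL) //.
  have : window N yd k *m g = 0 by rewrite -(entry_stackM _ _ kT) yp0 entry0.
  by rewrite YE // mulmxDl -!mulmxA u0 // mulmx0 addr0.
apply: eq_entry => k kT; rewrite entry_stackM // entry0.
have kL : (Ti + k < L)%N by lia.
by rewrite YE // mulmxDl -!mulmxA u0 // XA ?(ltnW kL) // X0 !mulmx0 addr0.
Qed.

End HankelTrajectories.

(** * Quadratic forms *)

Section QuadraticForms.
Context {R : realType}.

Definition bform (k : nat) (S : 'M[R]_k) (x y : 'cV[R]_k) : R :=
  (x^T *m S *m y) 0 0.

Lemma bformC (k : nat) (S : 'M[R]_k) (x y : 'cV[R]_k) : S^T = S ->
  bform S x y = bform S y x.
Proof.
move=> Ssym; rewrite /bform -[in LHS](trmxK (_ *m y)) mxE !trmx_mul trmxK.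
by rewrite Ssym mulmxA.
Qed.

Lemma trmxN (k l : nat) (S : 'M[R]_(k, l)) : (- S)^T = - S^T.
Proof. exact: linearN. Qed.

Lemma trmxDZ (k l : nat) (s : R) (x y : 'M[R]_(k, l)) :
  (x + s *: y)^T = x^T + s *: y^T.
Proof. by apply/matrixP => i j; rewrite !mxE. Qed.

Lemma qformDZ (k : nat) (S : 'M[R]_k) (x y : 'cV[R]_k) (s : R) : S^T = S ->
  qform S (x + s *: y) = qform S x + 2 * s * bform S x y + s ^+ 2 * qform S y.
Proof.
move=> Ssym; have yx : (y^T *m S *m x) 0 0 = bform S x y by rewrite bformC.
rewrite /qform trmxDZ !mulmxDl !mulmxDr -!scalemxAl -!scalemxAr.
have DZ (a b c : 'M[R]_1) :
    (a + s *: b + (s *: c + s *: (s *: (y^T *m S *m y)))) 0 0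
    = a 0 0 + s * b 0 0 + (s * c 0 0 + s * (s * qform S y)).
  by rewrite /qform; move: (y^T *m S *m y) => e; rewrite !mxE.
by rewrite DZ yx /qform /bform; ring.
Qed.

Lemma qformZ (k : nat) (S : 'M[R]_k) (s : R) (x : 'cV[R]_k) :
  qform S (s *: x) = s ^+ 2 * qform S x.
Proof.
rewrite -[s *: x]add0r /qform trmxDZ trmx0 !add0r -!scalemxAl -scalemxAr 2!mxE.
ring.
Qed.

Lemma qformDl (k : nat) (S S' : 'M[R]_k) (x : 'cV[R]_k) :
  qform (S + S') x = qform S x + qform S' x.
Proof. by rewrite /qform mulmxDr mulmxDl !mxE. Qed.

Lemma qformBl (k : nat) (S S' : 'M[R]_k) (x : 'cV[R]_k) :
  qform (S - S') x = qform S x - qform S' x.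
Proof. by rewrite /qform mulmxBr mulmxBl !mxE. Qed.

Lemma qformN (l : nat) (S : 'M[R]_l) (w : 'cV[R]_l) : qform (- S) w = - qform S w.
Proof. by rewrite /qform mulmxN mulNmx mxE. Qed.

Lemma qformZl (k : nat) (S : 'M[R]_k) (a : R) (x : 'cV[R]_k) :
  qform (a *: S) x = a * qform S x.
Proof. by rewrite /qform -scalemxAr -scalemxAl mxE. Qed.

Lemma qform_mul (k l : nat) (S : 'M[R]_k) (K : 'M[R]_(k, l)) (x : 'cV[R]_l) :
  qform S (K *m x) = qform (K^T *m S *m K) x.
Proof. by rewrite /qform trmx_mul !mulmxA. Qed.

Lemma qform_sum (k : nat) (S : 'M[R]_k) (x : 'cV[R]_k) :
  qform S x = \sum_i \sum_j S i j * (x i 0 * x j 0).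
Proof.
rewrite /qform mxE exchange_big /=; apply: eq_bigr => j _.
rewrite mxE big_distrl /=; apply: eq_bigr => i _; rewrite !mxE; ring.
Qed.

Lemma qform1 (k : nat) (x : 'cV[R]_k) : qform 1%:M x = \sum_i x i 0 ^+ 2.
Proof. by rewrite /qform mulmx1 mxE; apply: eq_bigr => i _; rewrite !mxE expr2. Qed.

Lemma posdef1 (k : nat) : posdef (1%:M : 'M[R]_k).
Proof.
split=> [|x xn0]; first exact: trmx1.
rewrite qform1 lt0r sumr_ge0 ?andbT => [|i _]; last exact: sqr_ge0.
apply: contra xn0 => /eqP /psumr_eq0P x0; apply/eqP/colP => i; rewrite mxE.
by apply/eqP; rewrite -sqrf_eq0; apply/eqP/x0 => // j _; rewrite sqr_ge0.
Qed.

Lemma posdef_ge0 (k : nat) (P : 'M[R]_k) (x : 'cV[R]_k) : posdef P -> 0 <= qform P x.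
Proof.
move=> [_ P0]; have [->|/P0/ltW//] := eqVneq x 0.
by rewrite /qform mulmx0 mxE.
Qed.

Lemma posdef_psd (k : nat) (P : 'M[R]_k) : posdef P -> psd P.
Proof. by move=> Ppos; split=> [|x]; [case: Ppos | apply: posdef_ge0]. Qed.

Lemma posdef_unitmx (k : nat) (P : 'M[R]_k) : posdef P -> P \in unitmx.
Proof.
move=> [Psym P0]; rewrite -row_free_unit; apply: inj_row_free => v vP.
apply/eqP/negPn/negP => vn0; have := P0 v^T; rewrite trmx_eq0 => /(_ vn0).
by rewrite /qform trmxK vP mul0mx mxE ltxx.
Qed.

Lemma negdef_posdefN (k : nat) (P : 'M[R]_k) : negdef P -> posdef (- P).
Proof.
by move=> [Psym P0]; split=> [|x /P0]; rewrite ?trmxN ?Psym // qformN oppr_gt0.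
Qed.

Lemma posdefD (k : nat) (P S : 'M[R]_k) : posdef P -> psd S -> posdef (P + S).
Proof.
move=> [Psym P0] [Ssym S0]; split=> [|x xn0].
  by apply/matrixP => i j; rewrite -[in RHS]Psym -[in RHS]Ssym !mxE.
by rewrite qformDl ltr_wpDr ?S0 ?P0.
Qed.

Lemma psd_congr (k l : nat) (S : 'M[R]_k) (K : 'M[R]_(k, l)) :
  psd S -> psd (K^T *m S *m K).
Proof.
move=> [Ssym S0]; split=> [|x]; first by rewrite !trmx_mul trmxK Ssym mulmxA.
by rewrite -qform_mul.
Qed.

Lemma posdef_congr (k l : nat) (P : 'M[R]_k) (K : 'M[R]_(k, l)) :
  posdef P -> row_free K^T -> posdef (K^T *m P *m K).
Proof.
move=> [Psym P0] Kfree; split=> [|x xn0]; first by rewrite !trmx_mul trmxK Psym mulmxA.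
rewrite -qform_mul P0 //; apply: contraNneq xn0 => Kx0.
by rewrite -trmx_eq0 -(mulmx_free_eq0 _ Kfree) -trmx_mul Kx0 trmx0.
Qed.

(** Full row rank makes [L L^T] positive definite, hence invertible. *)
Lemma mul_rpinv (a b : nat) (L : 'M[R]_(a, b)) : row_free L -> L *m rpinv L = 1%:M.
Proof.
move=> Lfree; rewrite /rpinv mulmxA mulmxV // -[X in X *m _]mulmx1.
have := @posdef_congr b a 1%:M L^T (posdef1 b); rewrite !trmxK => /(_ Lfree).
by rewrite mulmx1; apply: posdef_unitmx.
Qed.

Lemma discriminant_le0 (a b c : R) :
  (forall s, 0 <= a + 2 * s * b + s ^+ 2 * c) -> b ^+ 2 <= a * c.
Proof.
move=> ge0; have a0 : 0 <= a by have := ge0 0; lra.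
have c0 : 0 <= c.
  rewrite leNgt; apply/negP => c0.
  (* The values at [1 + t] and [- (1 + t)] average to [a + (1 + t)^2 c], which is negative since
     [t c = - a]. *)
  pose t := a / - c; have tc : t * - c = a by rewrite divfK // oppr_eq0 lt_eqF.
  have t0 : 0 <= t by rewrite divr_ge0 // oppr_ge0 ltW.
  by have := ge0 (1 + t); have := ge0 (- (1 + t)); nra.
have [c_eq0|cn0] := eqVneq c 0.
  have [->|bn0] := eqVneq b 0; first by rewrite expr0n mulr_ge0.
  (* At this point the affine function [a + 2 s b] takes the value -1. *)
  have := ge0 (- (a + 1) / (2 * b)); rewrite c_eq0 mulr0 addr0 => ge.
  suff : 2 * (- (a + 1) / (2 * b)) * b = - (a + 1) by lra.
  by field.
(* The minimiser of the quadratic. *)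
pose t := - b / c; have tc : t * c = - b by rewrite divfK.
have cpos : 0 < c by rewrite lt_neqAle eq_sym cn0.
have ge := ge0 t; have tc2 : t ^+ 2 * c = t * - b by rewrite expr2 -mulrA tc.
suff : 0 <= (a + t * b) * c by rewrite mulrDl mulrAC tc mulNr; lra.
by apply: mulr_ge0 => //; lra.
Qed.

Lemma cauchy_schwarz (k : nat) (S : 'M[R]_k) (x y : 'cV[R]_k) : psd S ->
  bform S x y ^+ 2 <= qform S x * qform S y.
Proof.
by move=> [Ssym S0]; apply: discriminant_le0 => s; rewrite -qformDZ.
Qed.

(** The coordinate [x i] is the [P]-inner product of [x] with [P^-1 e_i], so Cauchy-Schwarz gives
    the bound. *)
Lemma coord_le_posdef (k : nat) (P : 'M[R]_k) (i : 'I_k) : posdef P ->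
  exists2 c, 0 <= c & forall x : 'cV[R]_k, x i 0 ^+ 2 <= c * qform P x.
Proof.
move=> Ppos; have [Psym _] := Ppos.
pose e := invmx P *m delta_mx i 0 : 'cV[R]_k; exists (qform P e) => [|x].
  exact: posdef_ge0.
rewrite (_ : x i 0 = bform P e x); first exact/cauchy_schwarz/posdef_psd.
rewrite /bform /e trmx_mul trmx_inv Psym mulmxKV ?posdef_unitmx //.
by rewrite trmx_delta -rowE mxE.
Qed.

(** Each term [S i j x_i x_j] is at most [|S i j| (x_i^2 + x_j^2)], and [P] controls every squared
    coordinate. *)
Lemma posdef_dominates (k : nat) (P S : 'M[R]_k) : posdef P ->
  exists2 c, 0 <= c & forall x, qform S x <= c * qform P x.
Proof.
move=> Ppos; have /choice[c cP] i : exists c, 0 <= c /\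
    forall x : 'cV[R]_k, x i 0 ^+ 2 <= c * qform P x.
  by have [c c0 cP] := coord_le_posdef i Ppos; exists c.
exists (\sum_i \sum_j `|S i j| * (c i + c j)) => [|x].
  apply: sumr_ge0 => i _; apply: sumr_ge0 => j _.
  by rewrite mulr_ge0 // addr_ge0 // (cP _).1.
rewrite qform_sum mulr_suml; apply: ler_sum => i _.
rewrite mulr_suml; apply: ler_sum => j _; rewrite (le_trans (ler_norm _)) // normrM.
rewrite -mulrA ler_wpM2l // mulrDl.
rewrite (le_trans _ (lerD ((cP i).2 x) ((cP j).2 x))) // ler_norml.
by apply/andP; split; nra.
Qed.

Lemma col_mx00 (d : nat) (a : 'M[R]_1) (x : 'cV[R]_d) :
  (col_mx a x : 'cV[R]_(1 + d)) 0 0 = a 0 0.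
Proof.
have -> : 0 = lshift d (0 : 'I_1) by apply: val_inj.
by rewrite col_mxEu.
Qed.

Lemma cV_split (d : nat) (v : 'cV[R]_(1 + d)) : v = col_mx (v 0 0)%:M (dsubmx v).
Proof.
rewrite -[LHS]vsubmxK [usubmx v]mx11_scalar mxE.
by congr (col_mx (v _ _)%:M _); apply: val_inj.
Qed.

Lemma qform_corner (d : nat) (a : 'M[R]_1) (v : 'cV[R]_(1 + d)) :
  qform (block_mx a 0 0 0) v = a 0 0 * v 0 0 ^+ 2.
Proof.
rewrite [v in LHS]cV_split /qform tr_col_mx mul_row_block mul_row_col.
rewrite !mulmx0 !addr0 mul0mx addr0 mxE big_ord1 mxE big_ord1 !mxE.
by rewrite eqxx mulr1n; ring.
Qed.

End QuadraticForms.

(** * Predicted outputs *)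

Section Prediction.
Context {R : realType} {a b c e q1 q2 N : nat}.
Variables (Up : 'M[R]_(a, N)) (Yp : 'M[R]_(b, N)) (Uf : 'M[R]_(c, N)).
Variables (Yf : 'M[R]_(e, N)).
Variables (Eq : (q1 + q2 = b)%N) (PY : 'M[R]_b).
Variables (Yp1 : 'M[R]_(q1, N)) (Yp2 : 'M[R]_(q2, N)).
Local Notation Lambda := (col_mx Up (col_mx Yp1 Uf)).

(** The system enters this section only through this uniqueness of the output and, next, the free
    choice of the future input. *)
Hypothesis Yf_eq0 : forall g : 'cV[R]_N,
  Up *m g = 0 -> Yp *m g = 0 -> Uf *m g = 0 -> Yf *m g = 0.
Hypothesis change_input : forall (g : 'cV[R]_N) (u : 'cV[R]_c),
  exists h, [/\ Up *m h = Up *m g, Yp *m h = Yp *m g & Uf *m h = u].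
Hypothesis PYp : PY *m Yp = castmx (Eq, erefl) (col_mx Yp1 Yp2).
Hypothesis Lambda_free : row_free Lambda.
Hypothesis rank_Lambda : \rank Lambda = \rank (col_mx Up (col_mx Yp Uf)).

Lemma Yp1_sub_Yp : exists K, Yp1 = K *m Yp.
Proof.
exists (usubmx (castmx (esym Eq, erefl) PY)).
rewrite mul_usub_mx; have := congr1 (castmx (esym Eq, esym erefl)) PYp.
rewrite castmxK castmx_mul castmx_id => ->; by rewrite col_mxKu.
Qed.

(** The rows of [Lambda] lie in the row space of the full data matrix; equal ranks make the row
    spaces, hence the kernels, coincide. *)
Lemma Lambda_kernel (g : 'cV[R]_N) : Lambda *m g = 0 ->
  [/\ Up *m g = 0, Yp *m g = 0 & Uf *m g = 0].
Proof.
have [K YpK] := Yp1_sub_Yp.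
have LF : (Lambda <= col_mx Up (col_mx Yp Uf))%MS.
  by rewrite -addsmxE -(addsmxE Up) addsmxS // -!addsmxE addsmxS // YpK submxMl.
have := mxrank_leqif_eq LF; rewrite rank_Lambda => /leqif_refl /andP[_ /submxP[D FE]] Lg.
have /eqP : col_mx Up (col_mx Yp Uf) *m g = 0 by rewrite FE -mulmxA Lg mulmx0.
by rewrite !mul_col_mx !col_mx_eq0 => /and3P[/eqP ? /eqP ? /eqP ?].
Qed.

(** Any [g] matching the past data serves, whatever its future input: [B_ini] removes the
    contribution of [Uf g] and [B_u] adds that of [u]. *)
Lemma predicted_outputE (uini : 'cV[R]_a) (yini w : 'cV[R]_b) (u : 'cV[R]_c)
    (g : 'cV[R]_N) :
  Up *m g = uini -> Yp *m g = yini - w ->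
  predicted_output Up Yp Uf Yf uini yini u w
  = B_u Up Yp1 Uf Yf *m u + B_ini Up Yp1 Uf Yf *m g.
Proof.
move=> ug yg; have [h [uh yh fh]] := change_input g u.
(* h' has the right past inputs, the right rows Yp1 and the right future input;
   the rank condition then identifies it with h on all of Yp. *)
have [K YpK] := Yp1_sub_Yp.
pose h' := g + rpinv Lambda *m col_mx 0 (col_mx 0 (u - Uf *m g)).
have Bh' : B_u Up Yp1 Uf Yf *m u + B_ini Up Yp1 Uf Yf *m g = Yf *m h'.
  rewrite /B_u /B_ini /h'; move: (rpinv Lambda) => P.
  rewrite -!mulmxA -mulmxDr mulmxDl mul1mx addrCA -!mulmxA -mulmxDr.
  by rewrite !mul_col_mx !mul0mx mul1mx mulNmx !add_col_mx !addr0.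
have /Lambda_kernel[u0 y0 f0] : Lambda *m (h - h') = 0.
  rewrite mulmxBr [Lambda *m h']mulmxDr mulmxA mul_rpinv // mul1mx.
  rewrite !mul_col_mx uh fh YpK -!mulmxA yh !add_col_mx !addr0 subrKC.
  by rewrite subrr.
have -> : B_u Up Yp1 Uf Yf *m u + B_ini Up Yp1 Uf Yf *m g = Yf *m h.
  by rewrite Bh'; apply/esym/eqP; rewrite -subr_eq0 -mulmxBr Yf_eq0.
(* The witness [h] rules out the default value of [xget], and any other solution has the same output
   by [Yf_eq0]. *)
apply: xget_unique => [|y [g']] /=.
  by exists h; rewrite !mul_col_mx uh yh fh ug yg.
rewrite !mul_col_mx => /eq_col_mx[u' /eq_col_mx[y' /eq_col_mx[f' <-]]].
apply/eqP; rewrite -subr_eq0 -mulmxBr; apply/eqP/Yf_eq0; rewrite mulmxBr.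
- by rewrite u' uh ug subrr.
- by rewrite y' yh yg subrr.
- by rewrite f' fh subrr.
Qed.

(** For zero data and zero input, both [g] and 0 represent the past, and the predicted output is the
    same for either. *)
Lemma B_ini_eq0 (g : 'cV[R]_N) :
  Up *m g = 0 -> Yp *m g = 0 -> B_ini Up Yp1 Uf Yf *m g = 0.
Proof.
move=> ug yg; have := @predicted_outputE 0 0 0 0 g ug; rewrite subr0 => /(_ yg).
have := @predicted_outputE 0 0 0 0 0 (mulmx0 _ _); rewrite subr0 => /(_ (mulmx0 _ _)).
by rewrite !mulmx0 !add0r => -> /esym.
Qed.

End Prediction.

(** * The S-lemma *)

Section SProcedure.
Context {R : realType}.

(** The first quadratic has roots [s1 < 0 < s2] with [s1 s2 = f / f'], and the second is nonnegative
    at both. Divided by [f f'], the conclusion says that the ratio [g' / f'] is at most [g / f]. *)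
Lemma quadratic_comparison (f b f' g c g' : R) : 0 < f -> f' < 0 ->
  (forall s, 0 <= f + 2 * s * b + s ^+ 2 * f' ->
             0 <= g + 2 * s * c + s ^+ 2 * g') ->
  g * f' <= g' * f.
Proof.
move=> f0 f'0 imp; pose D := Num.sqrt (b ^+ 2 - f * f').
have D2 : D ^+ 2 = b ^+ 2 - f * f' by rewrite sqr_sqrtr //; nra.
have D0 : 0 <= D by apply: sqrtr_ge0.
have [bD Db] : - D < b /\ b < D by split; nra.
pose s1 := (D - b) / f'; pose s2 := (- D - b) / f'.
have s1f : s1 * f' = D - b by rewrite /s1 divfK // lt_eqF.
have s2f : s2 * f' = - D - b by rewrite /s2 divfK // lt_eqF.
have s1lt : s1 < 0 by nra.
have s2gt : 0 < s2 by nra.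
have s12 : s1 * s2 * f' = f.
  by apply: (mulIf (ltr0_neq0 f'0)); rewrite -(mulrA s1) mulrAC s1f s2f; lra.
have root1 : f + 2 * s1 * b + s1 ^+ 2 * f' = 0.
  apply: (mulIf (ltr0_neq0 f'0)); rewrite mul0r.
  have -> : (f + 2 * s1 * b + s1 ^+ 2 * f') * f'
    = f * f' + 2 * (s1 * f') * b + (s1 * f') ^+ 2 by ring.
  by rewrite s1f; lra.
have root2 : f + 2 * s2 * b + s2 ^+ 2 * f' = 0.
  apply: (mulIf (ltr0_neq0 f'0)); rewrite mul0r.
  have -> : (f + 2 * s2 * b + s2 ^+ 2 * f') * f'
    = f * f' + 2 * (s2 * f') * b + (s2 * f') ^+ 2 by ring.
  by rewrite s2f; lra.
have g1 := imp s1; rewrite root1 lexx in g1; have {g1} := g1 isT => g1.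
have g2 := imp s2; rewrite root2 lexx in g2; have {g2} := g2 isT => g2.
(* s2 times the first value minus s1 times the second eliminates c. *)
have g12 : 0 <= (s2 - s1) * (g - s1 * s2 * g').
  have -> : (s2 - s1) * (g - s1 * s2 * g') =
    s2 * (g + 2 * s1 * c + s1 ^+ 2 * g') + - s1 * (g + 2 * s2 * c + s2 ^+ 2 * g').
    by ring.
  by rewrite addr_ge0 // mulr_ge0 // ?oppr_ge0 ltW.
have {g12} g12 : 0 <= g - s1 * s2 * g' by rewrite pmulr_rge0 // in g12; lra.
rewrite -s12; nra.
Qed.

(** A multiplier must lie above the ratios [G / F] where [F < 0] and below them where [F > 0].
    [quadratic_comparison] on the line through two such points orders these ratios, so a supremum
    works; putting 0 in [E] makes it nonnegative. *)
Lemma s_lemma (k : nat) (F G : 'M[R]_k) (v0 : 'cV[R]_k) :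
  F^T = F -> G^T = G -> 0 < qform F v0 ->
  (forall v, 0 <= qform F v -> 0 <= qform G v) ->
  exists2 alpha, 0 <= alpha & forall v, alpha * qform F v <= qform G v.
Proof.
move=> Fsym Gsym F0 FG.
pose E := [set a | a = 0 \/ exists2 v, qform F v < 0 & a = qform G v / qform F v].
have Eub v : 0 < qform F v -> ubound E (qform G v / qform F v).
  move=> Fv a [->|[v' Fv' ->]]; first by rewrite divr_ge0 ?(ltW Fv) // FG // ltW.
  rewrite ler_ndivrMr // mulrAC ler_pdivrMr //.
  apply: (@quadratic_comparison _ (bform F v v') _ _ (bform G v v')) => // s.
  by rewrite -!qformDZ //; apply: FG.
have Esup : has_sup E by split; [exists 0; left | exists (qform G v0 / qform F v0); apply: Eub].
exists (sup E) => [|v]; first by apply: ub_le_sup; [case: Esup | left].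
case: (ltgtP (qform F v) 0) => Fv.
- by rewrite -ler_ndivrMr //; apply: ub_le_sup; [case: Esup | right; exists v].
- by rewrite -ler_pdivlMr //; apply: sup_le_ub; [case: Esup | apply: Eub].
- by rewrite Fv mulr0 FG // Fv.
Qed.

End SProcedure.

Section Inhomogeneous.
Context {R : realType} {d : nat}.
Variables (A T : 'M[R]_(1 + d)).
Local Notation aff x := (col_mx 1%:M x : 'cV[R]_(1 + d)).
Local Notation lin x := (col_mx 0 x : 'cV[R]_(1 + d)).
Hypotheses (Asym : A^T = A) (Tpsd : psd T).
Variables (kappa : R) (x0 : 'cV[R]_d) (c : R).
Hypothesis kappa_ge0 : 0 <= kappa.
Hypothesis T_dominated : forall s, qform T (lin s) <= - kappa * qform A (lin s).
Hypothesis x0_feasible : 0 <= qform A (aff x0).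
Hypothesis T_le : forall x, 0 <= qform A (aff x) -> qform T (aff x) <= c.

(** With a strictly feasible point this is the S-lemma after homogenisation. Without one, the
    multiplier is explicit and has [gamma - J] in a denominator, [J] being the cost at [x0]; the
    strict inequality keeps it finite. *)
Lemma inexact_s_procedure (gamma : R) : c < gamma ->
  exists2 alpha, 0 <= alpha & forall v : 'cV[R]_(1 + d),
    alpha * qform A v + qform T v <= gamma * (v 0 0) ^+ 2.
Proof.
move=> cg; have [Tsym T0] := Tpsd.
pose E : 'M[R]_(1 + d) := block_mx gamma%:M 0 0 0.
have qE v : qform E v = gamma * v 0 0 ^+ 2 by rewrite qform_corner mxE mulr1n.
have ET : (E - T)^T = E - T.
  by rewrite [LHS]linearB /= Tsym tr_block_mx tr_scalar_mx !trmx0.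
have [[x1 Ax1]|noslater] := pselect (exists x, 0 < qform A (aff x)).
  have [v Av|alpha a0 H] := @s_lemma R _ A (E - T) (aff x1) Asym ET Ax1; last first.
    by exists alpha => // v; have := H v; rewrite qformBl qE; lra.
  (* A vector with first coordinate 0 is a direction, handled by [T_dominated]; any other is
     rescaled to first coordinate 1. *)
  rewrite qformBl qE subr_ge0; have [v0|v0] := eqVneq (v 0 0) 0.
    have vE : v = lin (dsubmx v) by rewrite [LHS]cV_split v0 raddf0.
    rewrite v0 expr0n mulr0 vE (le_trans (T_dominated _)) //.
    by rewrite vE in Av; rewrite mulNr oppr_le0 mulr_ge0.
  have vE : v = v 0 0 *: aff ((v 0 0)^-1 *: dsubmx v).
    by rewrite scale_col_mx scalerA divff // scale1r scalemx1 -cV_split.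
  move: Av; rewrite {1 2}vE !qformZ pmulr_rge0 ?exprn_even_gt0 // => /T_le H.
  rewrite mulrC ler_wpM2r ?sqr_ge0 // (le_trans H) // ltW //.
have A0 x : qform A (aff x) <= 0.
  by rewrite leNgt; apply/negP => Ax; apply: noslater; exists x.
have Ax0 : qform A (aff x0) = 0 by apply/eqP; rewrite eq_le A0 x0_feasible.
have affDl s t : aff x0 + t *: lin s = aff (x0 + t *: s).
  by rewrite scale_col_mx scaler0 add_col_mx addr0.
have A_aff s t : 0 + 2 * t * bform A (aff x0) (lin s) + t ^+ 2 * qform A (lin s) <= 0.
  by rewrite -Ax0 -qformDZ // affDl Ax0.
(* Without a strictly feasible point, A is maximal and stationary at x0. *)
have bA0 s : bform A (aff x0) (lin s) = 0.
  apply/eqP; rewrite -sqrf_eq0 eq_le sqr_ge0 andbT -sqrrN -[leRHS](mul0r (- qform A (lin s))).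
  by apply: discriminant_le0 => t; have := A_aff s t; lra.
have Alin s : qform A (lin s) <= 0 by have := A_aff s 1; rewrite bA0; lra.
pose J := qform T (aff x0).
have J0 : 0 <= J by apply: T0.
have JC : J <= c by apply: T_le.
(* The part [kappa] absorbs the quadratic term [Q] of [T]; the other part absorbs the cross term
   [2 t b], as [b^2 <= Q J] by Cauchy-Schwarz. *)
exists (kappa + J * kappa / (gamma - J)) => [|v].
  by rewrite addr_ge0 // divr_ge0 ?mulr_ge0 // subr_ge0; lra.
set t := v 0 0; pose s := dsubmx v - t *: x0.
have -> : v = lin s + t *: aff x0.
  by rewrite scale_col_mx add_col_mx add0r subrK scalemx1 -cV_split.
rewrite !qformDZ // Ax0 (bformC _ _ Asym) bA0 -/J.
set b := bform T _ _; set P := qform A (lin s); set Q := qform T (lin s).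
have CS : b ^+ 2 <= Q * J by apply: cauchy_schwarz.
have QP : Q <= - kappa * P by apply: T_dominated.
have P0 : P <= 0 by apply: Alin.
pose e := gamma - J; have e0 : 0 < e by rewrite subr_gt0; lra.
pose m := J * kappa / e * - P; have me : m * e = J * kappa * - P.
  by rewrite /m mulrAC divfK // gt_eqF.
have bm : b ^+ 2 <= m * e.
  rewrite me (le_trans CS) // [Q * J]mulrC -mulrA ler_wpM2l //; lra.
have tb : 2 * t * b <= e * t ^+ 2 + m.
  rewrite -(ler_pM2l e0).
  have := sqr_ge0 (e * t - b); rewrite sqrrB -subr_ge0; nra.
have -> : (kappa + J * kappa / e) * (P + 2 * t * 0 + t ^+ 2 * 0) = kappa * P - m.
  by rewrite /m; ring.
have -> : gamma = e + J by rewrite subrK.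
nra.
Qed.
End Inhomogeneous.

(** * Existence of a worst noise *)

Section Maximum.
Import numFieldNormedType.Exports.
Context {R : realType}.

Lemma continuous_quadratic_sum (T : topologicalType) (k : nat) (S : 'M[R]_k)
    (f : 'I_k -> T -> R) : (forall i, continuous (f i)) ->
  continuous (fun x => \sum_i \sum_j S i j * (f i x * f j x)).
Proof.
move=> cf; apply: continuous_big => [|i _]; first exact: add_continuous.
apply: continuous_big => [|j _] x; first exact: add_continuous.
by apply: cvgM; [exact: cvg_cst | apply: cvgM; exact: cf].
Qed.

Lemma continuous_affine_sum (T : topologicalType) (k : nat) (e : R) (D : 'I_k -> R)
    (f : 'I_k -> T -> R) : (forall i, continuous (f i)) ->
  continuous (fun x => e + \sum_j D j * f j x).
Proof.
move=> cf x; apply: cvgD; first exact: cvg_cst.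
apply: continuous_big => [|j _ {}x]; first exact: add_continuous.
by apply: cvgM; [exact: cvg_cst | exact: cf].
Qed.

Lemma qform_affine_continuous (k l : nat) (S : 'M[R]_k) (e : 'cV[R]_k)
    (D : 'M[R]_(k, l)) :
  continuous (fun v : 'rV[R]_l => qform S (e + D *m v^T)).
Proof.
have -> : (fun v : 'rV[R]_l => qform S (e + D *m v^T)) = (fun v =>
    \sum_i \sum_j S i j * ((e i 0 + \sum_h D i h * v 0 h) *
                           (e j 0 + \sum_h D j h * v 0 h))).
  apply/funext => v; rewrite qform_sum.
  apply: eq_bigr => i _; apply: eq_bigr => j _; rewrite !mxE.
  by congr (_ * ((_ + _) * (_ + _))); apply: eq_bigr => h _; rewrite mxE.
apply: (continuous_quadratic_sum (f := fun i (v : 'rV[R]_l) => e i 0 + \sum_h D i h * v 0 h)) => i.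
apply: (continuous_affine_sum (f := fun h (v : 'rV[R]_l) => v 0 h)) => h.
exact: coord_continuous.
Qed.

Lemma qform_aff (l : nat) (F11 : 'M[R]_1) (F12 : 'rV[R]_l) (F22 : 'M[R]_l)
    (w : 'cV[R]_l) :
  qform (block_mx F11 F12 F12^T F22) (col_mx 1%:M w)
  = F11 0 0 + 2 * (F12 *m w) 0 0 + qform F22 w.
Proof.
have tF : (w^T *m F12^T) 0 0 = (F12 *m w) 0 0 by rewrite -trmx_mul mxE.
rewrite /qform tr_col_mx mul_row_block mul_row_col trmx1 !mul1mx mulmx1.
rewrite mulmxDl mxE [X in X + _]mxE [X in _ + X]mxE tF; ring.
Qed.

Lemma coord_le_qform1 (k : nat) (x : 'cV[R]_k) (i : 'I_k) : `|x i 0| <= 1 + qform 1%:M x.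
Proof.
have : x i 0 ^+ 2 <= qform 1%:M x.
  by rewrite qform1 (bigD1 i) //= lerDl sumr_ge0 // => j _; apply: sqr_ge0.
rewrite -real_normK ?num_real // => le; have := normr_ge0 (x i 0); nra.
Qed.

(** The linear term is at most a constant plus half of the form of [- F22], so the constraint bounds
    that form and with it every coordinate. *)
Lemma negdef_superlevel_bounded (l : nat) (F11 : 'M[R]_1) (F12 : 'rV[R]_l)
    (F22 : 'M[R]_l) : negdef F22 ->
  exists B, forall w : 'cV[R]_l,
    0 <= qform (block_mx F11 F12 F12^T F22) (col_mx 1%:M w) ->
    forall i, `|w i 0| <= B.
Proof.
move=> /negdef_posdefN Ppos.
have [c c0 cP] := posdef_dominates 1%:M Ppos.
have [b b0 bP] := posdef_dominates (F12^T *m F12) Ppos.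
(* On the set, [2 F11 + 4 (b + 1)] bounds the form of [- F22]; the factor [c] passes to the sum of
   squares, and [1 +] to absolute values. *)
exists (1 + c * (2 * F11 0 0 + 4 * (b + 1))) => w.
rewrite qform_aff => Fw i; apply: (le_trans (coord_le_qform1 _ _)).
rewrite lerD2l (le_trans (cP w)) // ler_wpM2l //.
have PN : qform (- F22) w = - qform F22 w.
  exact: qformN.
have := bP w; rewrite PN.
have -> : qform (F12^T *m F12) w = (F12 *m w) 0 0 ^+ 2.
  rewrite /qform mulmxA -trmx_mul -mulmxA mxE big_ord1 !mxE expr2 //.
set z := (F12 *m w) 0 0 in Fw *; move=> bz.
have z2 : 2 * z * (b + 1) * 2 <= 4 * (b + 1) ^+ 2 + z ^+ 2.
  have := sqr_ge0 (z - 2 * (b + 1)); nra.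
have P0 : 0 <= - qform F22 w by rewrite -PN posdef_ge0.
have bb : 0 < 2 * (b + 1) by lra.
suff z3 : 2 * z <= 2 * (b + 1) + 1 / 2 * - qform F22 w by lra.
rewrite -(ler_pM2l bb); move: (- qform F22 w) P0 bz z2 => P P0 bz z2; clear -P0 bz z2 b0. nra.
Qed.

(** The feasible set is closed and bounded, hence compact, so the extreme value theorem applies
    without any concavity. The equation [C w = c] will express that [w] is compatible with the
    data. *)
Lemma quadratic_max (k l h : nat) (F11 : 'M[R]_1) (F12 : 'rV[R]_l) (F22 : 'M[R]_l)
    (C : 'M[R]_(h, l)) (c : 'cV[R]_h) (S : 'M[R]_k) (e : 'cV[R]_k) (D : 'M[R]_(k, l)) :
  let feas w := C *m w = c /\
    0 <= qform (block_mx F11 F12 F12^T F22) (col_mx 1%:M w) in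
  negdef F22 -> (exists w, feas w) ->
  exists2 w, feas w & forall w', feas w' ->
    qform S (e + D *m w') <= qform S (e + D *m w).
Proof.
move=> feas Fneg [w0 w0P].
have [B BP] := negdef_superlevel_bounded F11 F12 Fneg.
pose K : set 'rV[R]_l := [set v | feas v^T].
have K0 : K !=set0 by exists w0^T; rewrite /K /= trmxK.
have Kcompact : compact K.
  apply: bounded_closed_compact.
    exists `|B|; split=> [|M BM v [_ /BP vB]]; first exact: num_real.
    rewrite /= [leLHS]/Num.norm /= mx_normrE; apply/bigmax_leP; split=> [|[i j] _ /=].
      by rewrite (le_trans _ (ltW BM)).
    by have := vB j; rewrite mxE ord1 => /le_trans -> //; rewrite (le_trans (ler_norm B)) // ltW.
  (* The equation C w = c is written as the inequality - |C w - c|^2 >= 0. *)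
  pose q1 v := qform (- 1%:M) (- c + C *m v^T : 'cV[R]_h).
  pose q2 v := qform (block_mx F11 F12 F12^T F22)
    (col_mx 1%:M 0 + col_mx 0 1%:M *m v^T).
  rewrite (_ : K = [set v | 0 <= q1 v] `&` [set v | 0 <= q2 v]).
    have closed_nonneg (q : 'rV[R]_l -> R) : continuous q -> closed [set v | 0 <= q v].
      move=> cq; have := @preimage_closed _ _ q [set x : R | 0 <= x].
      by apply; [move=> v _; apply: cq | apply: closed_ge].
    by apply: closedI; apply: closed_nonneg; apply: qform_affine_continuous.
  have q2E v : q2 v = qform (block_mx F11 F12 F12^T F22) (col_mx 1%:M v^T).
    by rewrite /q2 mul_col_mx mul0mx mul1mx add_col_mx addr0 add0r.
  have q1E v : q1 v = - qform 1%:M (- c + C *m v^T).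
    exact: qformN.
  apply/seteqP; split=> v; rewrite /K /feas /= q2E q1E.
    move=> [-> ?]; split=> //.
    by rewrite addrC subrr /qform mulmx0 mxE oppr0.
  move=> [le0 ?]; split=> //; apply/eqP; rewrite -subr_eq0 addrC.
  apply/negPn/negP => /(proj2 (posdef1 h)); rewrite ltNge; lra.
have [|v] := compact_EVT_max (f := fun v => qform S (e + D *m v^T)) K0 Kcompact.
  by apply: continuous_subspaceT; apply: qform_affine_continuous.
rewrite inE => vK vmax; exists v^T => // w' w'P.
by have := vmax w'^T; rewrite inE /K /= trmxK; apply.
Qed.

End Maximum.

(** * The matrix inequality *)

Section Schur.
Context {R : realType}.

(** Completion of the square in [h]. *)
Lemma qform_schur (k l : nat) (W : 'M[R]_k) (U : 'M[R]_(k, l)) (S : 'M[R]_l)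
    (h : 'cV[R]_k) (v : 'cV[R]_l) : posdef W ->
  qform (block_mx (invmx W) U U^T S) (col_mx h v)
  = qform (invmx W) (h + W *m (U *m v)) + qform (S - U^T *m W *m U) v.
Proof.
move=> Wpos; have [Wsym _] := Wpos; have Wu := posdef_unitmx Wpos.
rewrite qformBl -qform_mul /qform tr_col_mx mul_row_block mul_row_col.
set g := U *m v.
have -> : (h + W *m g)^T = h^T + g^T *m W.
  by rewrite [LHS]linearD /= trmx_mul Wsym.
have -> : (h^T + g^T *m W) *m invmx W *m (h + W *m g)
    = h^T *m invmx W *m h + h^T *m g + (g^T *m h + g^T *m W *m g).
  rewrite mulmxDl -(mulmxA g^T) mulmxV // mulmx1 mulmxDl !mulmxDr.
  by rewrite -(mulmxA h^T (invmx W) (W *m g)) mulKmx // (mulmxA g^T).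
rewrite !mulmxDl -!addrA.
have -> : v^T *m U^T = g^T by rewrite -trmx_mul.
rewrite -(mulmxA h^T U v) -/g.
move: (h^T *m invmx W *m h) (h^T *m g) (g^T *m h) (g^T *m W *m g) (v^T *m S *m v).
by move=> a b c e f; rewrite !mxE; ring.
Qed.

Lemma psd_schur (k l : nat) (W : 'M[R]_k) (U : 'M[R]_(k, l)) (S : 'M[R]_l) :
  posdef W -> S^T = S ->
  psd (block_mx (invmx W) U U^T S) <->
  forall v, 0 <= qform (S - U^T *m W *m U) v.
Proof.
move=> Wpos Ssym; have [Wsym _] := Wpos; split=> [[_ ge0] v|ge0].
  (* This choice of [h] makes the completed square vanish. *)
  have := ge0 (col_mx (- (W *m (U *m v))) v).
  by rewrite qform_schur // addNr /qform mulmx0 mxE add0r.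
split=> [|x]; first by rewrite tr_block_mx trmxK Ssym trmx_inv Wsym.
rewrite -[x]vsubmxK qform_schur // addr_ge0 //.
have -> : invmx W = (invmx W)^T *m W *m invmx W.
  by rewrite trmx_inv Wsym mulVmx ?mul1mx ?posdef_unitmx.
by rewrite -qform_mul posdef_ge0.
Qed.

End Schur.

(** * The tracking problem in kernel coordinates *)

Section RobustTracking.
Context {R : realType} {b c d e : nat}.
Variables (Phi11 : 'M[R]_1) (Phi12 : 'rV[R]_b) (Phi22 : 'M[R]_b).
Variables (Qbar : 'M[R]_e) (Rbar : 'M[R]_c) (Bu : 'M[R]_(e, c)) (Bw : 'M[R]_(e, d)).
Variables (y0 r : 'cV[R]_e) (w0 : 'cV[R]_b) (Y : 'M[R]_(b, d)).

Let Phi := block_mx Phi11 Phi12 Phi12^T Phi22.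
(** The substitution [w = w0 - Y x] in homogeneous coordinates: [D] sends [(1, x)] to [(1, w)], and
    [A_w] is the pullback of [Phi]. *)
Let D : 'M[R]_(1 + b, 1 + d) := block_mx 1%:M 0 w0 (- Y).
Let Aw := A_w Phi11 Phi12 Phi22 w0 Y.

Definition tracking_cost (u : 'cV[R]_c) (x : 'cV[R]_d) : R :=
  qform Qbar (Bu *m u + y0 - r + Bw *m x) + qform Rbar u.

(** The homogenised tracking cost, so that [Q_g] is [gamma] in the corner minus this matrix. *)
Definition cost_form (u : 'cV[R]_c) : 'M[R]_(1 + d) :=
  let Z := row_mx (Bu *m u + y0 - r) Bw in
  block_mx (u^T *m Rbar *m u) 0 0 0 + Z^T *m Qbar *m Z.

Hypotheses (Phi22_neg : negdef Phi22) (Q_psd : psd Qbar) (R_pos : posdef Rbar).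
Hypothesis ker_Y : forall x : 'cV[R]_d, Y *m x = 0 -> Bw *m x = 0.

Lemma A_wE : Phi22^T = Phi22 ->
  Aw = D^T *m Phi *m D.
Proof.
move=> Psym; rewrite /D tr_block_mx !mulmx_block trmx1 trmx0 !mul1mx !mul0mx !add0r.
rewrite !mulmx1 !mulmx0 !add0r /Aw /A_w; congr block_mx.
- by rewrite mulmxDl addrA addrAC -!addrA addrCA !addrA.
- by rewrite mulmxN mulmxDl opprD.
- rewrite linearB linearN /= !trmx_mul trmxK Psym mulmxA.
  by rewrite trmxN !mulNmx.
- by rewrite trmxN mulmxN !mulNmx opprK.
Qed.

Lemma qform_A_w (x : 'cV[R]_d) :
  qform Aw (col_mx 1%:M x) = qform Phi (col_mx 1%:M (w0 - Y *m x)).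
Proof.
have [Psym _] := Phi22_neg.
by rewrite A_wE // -qform_mul /D mul_block_col !mulmx1 mul0mx addr0 mulNmx.
Qed.

Lemma A_w_sym : Phi11^T = Phi11 -> Aw^T = Aw.
Proof.
move=> P11; have [Psym _] := Phi22_neg.
have Phisym : Phi^T = Phi by rewrite /Phi tr_block_mx P11 trmxK Psym.
by rewrite A_wE // !trmx_mul trmxK Phisym mulmxA.
Qed.

Lemma qform_A_w_lin (s : 'cV[R]_d) : qform Aw (col_mx 0 s) = qform Phi22 (Y *m s).
Proof.
have [Psym _] := Phi22_neg.
rewrite A_wE // -qform_mul /D mul_block_col !mulmx0 mul0mx !add0r mulNmx.
rewrite /qform tr_col_mx trmx0 mul_row_block mul_row_col !mul0mx !add0r mulmx0 add0r.
by rewrite trmxN mulNmx mulmxN mulNmx opprK.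
Qed.

Lemma Q_gE (u : 'cV[R]_c) (gamma : R) :
  Q_g Qbar Rbar Bu Bw y0 r u gamma = block_mx gamma%:M 0 0 0 - cost_form u.
Proof.
have [Qsym _] := Q_psd; rewrite /Q_g /cost_form.
rewrite tr_row_mx mul_col_mx mul_col_row add_block_mx opp_block_mx add_block_mx.
rewrite !add0r; congr block_mx; first by rewrite opprD addrA.
by rewrite trmxN !trmx_mul trmxK Qsym mulmxA.
Qed.

Lemma cost_form_psd u : psd (cost_form u).
Proof.
have Zpsd := psd_congr (row_mx (Bu *m u + y0 - r) Bw) Q_psd.
split=> [|v].
  rewrite linearD /= (proj1 Zpsd) tr_block_mx !trmx0; congr (block_mx _ _ _ _ + _).
  by apply/matrixP => i j; rewrite mxE !ord1.
rewrite qformDl addr_ge0 ?(proj2 Zpsd) // qform_corner mulr_ge0 ?sqr_ge0 //.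
exact: posdef_ge0.
Qed.

Lemma qform_cost_form u x : qform (cost_form u) (col_mx 1%:M x) = tracking_cost u x.
Proof.
rewrite qformDl qform_corner -qform_mul mul_row_col mulmx1 addrC; congr (_ + _).
by rewrite col_mx00 [X in X ^+ 2]mxE expr1n mulr1.
Qed.

Lemma qform_cost_form_lin u s :
  qform (cost_form u) (col_mx 0 s) = qform Qbar (Bw *m s).
Proof.
rewrite qformDl qform_corner -qform_mul mul_row_col mulmx0 add0r.
by rewrite col_mx00 [X in X ^+ 2]mxE expr0n mulr0 add0r.
Qed.

(** The Schur complement subtracts from the corner exactly the term [u^T W u] that was added to
    [Q_g], leaving [Q_g - alpha A_w]. *)
Lemma psd_lmi_mx u gamma alpha :
  psd (lmi_mx Qbar Rbar Bu Bw y0 r Aw u gamma alpha) <->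
  forall v : 'cV[R]_(1 + d),
    alpha * qform Aw v + qform (cost_form u) v <= gamma * v 0 0 ^+ 2.
Proof.
rewrite /lmi_mx; set W := Rbar + _.
have Wpos : posdef W by apply: posdefD R_pos (psd_congr _ Q_psd).
have -> : col_mx u^T 0 = (row_mx u 0)^T :> 'M[R]_(1 + d, c).
  by rewrite tr_row_mx trmx0.
have UWU : (row_mx u 0)^T *m W *m row_mx u 0
    = block_mx (u^T *m W *m u) 0 0 0 :> 'M[R]_(1 + d).
  by rewrite tr_row_mx trmx0 !mul_col_mx mul0mx !mul_mx_row mul0mx !mulmx0 -/(block_mx _ _ _ _).
have sym11 (a : 'M[R]_1) : a^T = a by apply/matrixP => i j; rewrite mxE !ord1.
rewrite psd_schur //; last first.
  have cornerT (a : 'M[R]_1) :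
      (block_mx a 0 0 0)^T = block_mx a 0 0 0 :> 'M[R]_(1 + d).
    by rewrite tr_block_mx sym11 !trmx0.
  rewrite Q_gE; have [Tsym _] := cost_form_psd u; have Asym := A_w_sym (sym11 _).
  rewrite linearB linearD linearB linearZ /= !cornerT Tsym; congr (_ - _ *: _).
  exact: Asym.
split=> H v; have := H v;
  by rewrite UWU addrAC addrK Q_gE !qformBl qformZl qform_corner mxE mulr1n; lra.
Qed.

(** Inclusion of kernels is inclusion of row spaces; thus the output depends on [x] only through the
    noise [w0 - Y x]. *)
Lemma Bw_factor : exists K, Bw = K *m Y.
Proof.
apply/submxP; rewrite submxE; apply/eqP/matrixP => i j; rewrite [RHS]mxE.
have -> : (Bw *m cokermx Y) i j = (Bw *m col j (cokermx Y)) i 0.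
  by rewrite [LHS]mxE [RHS]mxE; apply: eq_bigr => k _; rewrite [in RHS]mxE.
by rewrite ker_Y ?mxE // colE mulmxA mulmx_coker mul0mx.
Qed.

Lemma robust_tracking u :
  (exists x, 0 <= qform Phi (col_mx 1%:M (w0 - Y *m x))) ->
  exists x, [/\ 0 <= qform Phi (col_mx 1%:M (w0 - Y *m x)),
    forall x', 0 <= qform Phi (col_mx 1%:M (w0 - Y *m x')) ->
      tracking_cost u x' <= tracking_cost u x
  & infimums [set gamma | exists alpha, 0 <= alpha /\
      psd (lmi_mx Qbar Rbar Bu Bw y0 r Aw u gamma alpha)] (tracking_cost u x)].
Proof.
move=> [x0 x0_feas]; have [K BwK] := Bw_factor.
(* The kernel of [C] is the range of [Y], so [C w = C w0] describes the noises [w0 - Y x]. *)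
pose C := (cokermx Y^T)^T.
have CP w : C *m w = C *m w0 <-> exists x, w = w0 - Y *m x.
  split=> [Cw|[x ->]]; last first.
    rewrite mulmxBr (mulmxA C) -{1}(trmxK Y) -trmx_mul mulmx_coker trmx0 mul0mx subr0 //.
  have : ((w0 - w)^T <= Y^T)%MS.
    by rewrite submxE -[X in _ *m X]trmxK -trmx_mul mulmxBr -/C Cw subrr trmx0.
  move=> /submxP[x wx]; exists x^T; apply: trmx_inj.
  by rewrite linearB /= trmx_mul trmxK -wx linearB /= subKr.
have [|w [/CP[x ->] xfeas] wmax] := @quadratic_max R _ _ _ Phi11 Phi12 Phi22 C (C *m w0)
    Qbar (Bu *m u + y0 - r + K *m w0) (- K) Phi22_neg.
  by exists (w0 - Y *m x0); split=> //; apply/CP; exists x0.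
have costE x' : qform Qbar (Bu *m u + y0 - r + K *m w0 + - K *m (w0 - Y *m x'))
    = tracking_cost u x' - qform Rbar u.
  rewrite /tracking_cost addrK mulmxBr !mulNmx opprK BwK mulmxA; congr qform.
  by rewrite -addrA; congr (_ + _); rewrite addrA subrr add0r.
have xmax x' : 0 <= qform Phi (col_mx 1%:M (w0 - Y *m x')) ->
    tracking_cost u x' <= tracking_cost u x.
  move=> x'feas; have := wmax (w0 - Y *m x').
  rewrite !costE lerD2r; apply; split=> //; by apply/CP; exists x'.
exists x; split=> //; split.
  (* Evaluation at [(1, x)] with [x] feasible, where the multiplier term is nonnegative. *)
  move=> gamma [alpha [alpha0 /psd_lmi_mx /(_ (col_mx 1%:M x))]].
  rewrite qform_cost_form qform_A_w -/Phi.
  rewrite col_mx00 [X in X ^+ 2]mxE expr1n mulr1.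
  by apply: le_trans; rewrite lerDr mulr_ge0.
move=> m mlb; rewrite leNgt; apply/negP => lt_m.
(* A lower bound [m] above the maximal cost would leave room for this midpoint, which has a
   multiplier. *)
pose gamma := (tracking_cost u x + m) / 2.
have [gx gm] : tracking_cost u x < gamma /\ gamma < m by rewrite /gamma; split; lra.
have Npos := negdef_posdefN Phi22_neg.
(* Since [Bw = K Y], this constant yields the domination of the cost along directions. *)
have [kappa kappa0 kP] := posdef_dominates (K^T *m Qbar *m K) Npos.
have [||||alpha alpha0 H] := @inexact_s_procedure R d Aw (cost_form u)
    _ (cost_form_psd u) kappa x (tracking_cost u x) kappa0 _ _ _ gamma gx.
- by apply: A_w_sym; apply/matrixP => i j; rewrite mxE !ord1.
- move=> s; rewrite qform_cost_form_lin qform_A_w_lin BwK -mulmxA qform_mul.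
  by rewrite mulNr -mulrN -qformN.
- by rewrite qform_A_w.
- by move=> x'; rewrite qform_A_w qform_cost_form; apply: xmax.
have /mlb : [set gamma | exists alpha, 0 <= alpha /\
      psd (lmi_mx Qbar Rbar Bu Bw y0 r Aw u gamma alpha)] gamma.
  by exists alpha; split=> //; apply/psd_lmi_mx.
by rewrite leNgt gm.
Qed.

End RobustTracking.

(** * Block-diagonal weights, kernels and infima *)

Section BlockWeights.
Context {R : realType}.

Lemma qform_tens1 (T q : nat) (S : 'M[R]_q) (v : 'cV[R]_(T * q)) :
  qform (1%:M *t S) v = \sum_(k < T) qform S (entry v k).
Proof.
have SvE : (1%:M *t S) *m v = stack T (fun k => S *m entry v k).
  apply/colP => i; case: (mxtens_indexP i) => k a.
  rewrite [RHS]mxE mxtens_indexK /= !mxE.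
  rewrite (reindex (fun kl : 'I_T * 'I_q => mxtens_index kl)) /=; last first.
    by exists (fun i => mxtens_unindex i) => j _; rewrite ?mxtens_indexK ?mxtens_unindexK.
  transitivity (\sum_(k' < T) \sum_(l < q)
      (1%:M *t S) (mxtens_index (k, a)) (mxtens_index (k', l)) * v (mxtens_index (k', l)) 0).
    by rewrite pair_bigA; apply: eq_bigr => -[].
  rewrite (bigD1 k) //= [X in _ + X]big1 ?addr0 => [|k' k'k].
    apply: eq_bigr => l _; rewrite tensmxE mxE eqxx mul1r mxE insubT //= => kT.
    by congr (S _ _ * v (mxtens_index (_, _)) _); apply: val_inj.
  by rewrite big1 // => l _; rewrite tensmxE mxE eq_sym (negbTE k'k) !mul0r.
rewrite /qform -mulmxA SvE mul_row_stack summxE.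
by apply: eq_bigr => k _; rewrite mulmxA.
Qed.

Lemma psd_tens1 (T q : nat) (S : 'M[R]_q) : psd S -> psd (1%:M *t S : 'M_(T * q)).
Proof.
move=> [Ssym S0]; split=> [|v]; first by rewrite trmx_tens trmx1 Ssym.
by rewrite qform_tens1 sumr_ge0.
Qed.

Lemma posdef_tens1 (T q : nat) (S : 'M[R]_q) :
  posdef S -> posdef (1%:M *t S : 'M_(T * q)).
Proof.
move=> Spos; have [Ssym S0] := Spos; split=> [|v vn0].
  by rewrite trmx_tens trmx1 Ssym.
rewrite qform_tens1 lt0r sumr_ge0 ?andbT => [|k _]; last exact: posdef_ge0.
apply: contra vn0 => /eqP /psumr_eq0P Sv0; apply/eqP/eq_entry => k kT.
have := Sv0 (fun k _ => posdef_ge0 _ Spos) (Ordinal kT) isT => /= Sk.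
suff -> : entry v k = 0 by rewrite entry0.
by apply/eqP/negPn/negP => /S0; rewrite Sk ltxx.
Qed.

Lemma lqteE (m p Tf : nat) (Q : 'M[R]_p) (Ru : 'M[R]_m) (r : 'cV[R]_(Tf * p))
    (u : 'cV[R]_(Tf * m)) (y : 'cV[R]_(Tf * p)) :
  lqte Q Ru r u y = qform (1%:M *t Q) (y - r) + qform (1%:M *t Ru) u.
Proof.
rewrite /lqte big_split !qform_tens1; congr (_ + _).
by apply: eq_bigr => k _; rewrite entryB.
Qed.

End BlockWeights.

Lemma row_free_col_mxu (F : fieldType) (k l n : nat) (A : 'M[F]_(k, n))
    (B : 'M[F]_(l, n)) : row_free (col_mx A B) -> row_free A.
Proof.
move=> AB; apply: inj_row_free => v vA.
have /eqP : row_mx v 0 *m col_mx A B = 0 by rewrite mul_row_col vA mul0mx addr0.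
by rewrite mulmx_free_eq0 // row_mx_eq0 => /andP[/eqP].
Qed.

Section KernelParametrization.
Context {R : realType} {a N d : nat}.
Variables (U : 'M[R]_(a, N)) (M : 'M[R]_(N, d)).
Hypothesis M_basis : ker_basis U M.

Lemma ker_basis_mul0 : U *m M = 0.
Proof.
have [_ MU] := M_basis; apply: trmx_inj; rewrite trmx_mul trmx0.
by apply/sub_kermxP; rewrite MU submx_refl.
Qed.

Lemma ker_basisP (g g0 : 'cV[R]_N) : U *m g = U *m g0 -> exists x, g = g0 + M *m x.
Proof.
move=> Ug; have [_ MU] := M_basis.
have : ((g - g0)^T <= M^T)%MS.
  by rewrite MU; apply/sub_kermxP; rewrite -trmx_mul mulmxBr Ug subrr trmx0.
move=> /submxP[x gx]; exists x^T; apply: trmx_inj.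
by rewrite linearD /= trmx_mul trmxK -gx linearB /= subrKC.
Qed.

End KernelParametrization.

Lemma infimums_unique (R : realType) (S : set R) (v w : R) :
  infimums S v -> infimums S w -> v = w.
Proof. by move=> Sv Sw; apply: (@is_subset1_infimums _ _ S). Qed.

(** The union and the family of infima have the same lower bounds; nonnegativity of [f] makes the
    global infimum exist. Optimality of [u] is expressed by infima, as a fibre need not attain its
    own. *)
Lemma inf_family (R : realType) (U : Type) (u0 : U) (S : U -> set R) (f : U -> R) :
  (forall u, 0 <= f u) -> (forall u, infimums (S u) (f u)) ->
  let all_S := [set x | exists u, S u x] in
  (exists v, infimums (range f) v /\ infimums all_S v) /\
  (forall u, (forall u', f u <= f u') <->
     exists v, infimums all_S v /\ infimums (S u) v).
Proof.
move=> f0 Sf all_S.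
have lb_all v : lbound all_S v <-> lbound (range f) v.
  split=> [vS _ [u _ <-]|vf x [u Sux]].
    by apply: (proj2 (Sf u)) => x Sux; apply: vS; exists u.
  by apply: le_trans (proj1 (Sf u) x Sux); apply: vf; exists u.
have inf_all v : infimums (range f) v <-> infimums all_S v.
  by split=> -[vlb vub]; split; try apply/lb_all => //; move=> w /lb_all; apply: vub.
have f_inf : has_inf (range f).
  by split; [exists (f u0), u0 | exists 0 => _ [u _ <-]].
have inf_f : infimums (range f) (inf (range f)).
  split; first by move=> x fx; apply: ge_inf => //; case: f_inf.
  by move=> w wlb; apply: lb_le_inf => //; case: f_inf.
split=> [|u]; first by exists (inf (range f)); split=> //; apply/inf_all.
split=> [umin|[v [vall vu]] u'].
  exists (f u); split=> //; apply/inf_all; split; first by move=> _ [u' _ <-].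
  by move=> w; apply; exists u.
have -> : f u = v by apply: infimums_unique vu.
by have /inf_all[vlb _] := vall; apply: vlb; exists u'.
Qed.

Lemma is_max_sup (R : realType) (S : set R) (v : R) : is_max S v -> sup S = v.
Proof.
move=> [Sv vub]; apply/eqP; rewrite eq_le; apply/andP; split.
  by apply: ge_sup => //; exists v.
by apply: ub_le_sup => //; exists v.
Qed.

(** * Assembly of the equivalence *)

Theorem theorem9 (R : realType) (n m p Ti Tf Td l : nat) (G : lti R n m p)
  (ud : 'cV[R]_(Td * m)) (yd : 'cV[R]_(Td * p))
  (uini : 'cV[R]_(Ti * m)) (yini : 'cV[R]_(Ti * p))
  (Phi11 : 'M[R]_1) (Phi12 : 'rV[R]_(Ti * p)) (Phi22 : 'M[R]_(Ti * p))
  (r : 'cV[R]_(Tf * p)) (Q : 'M[R]_p) (Ru : 'M[R]_m)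
  (d : nat) (M : 'M[R]_(Td.+1 - (Ti + Tf), d))
  (q1 q2 : nat) (Eq : (q1 + q2 = Ti * p)%N) (PY : 'M[R]_(Ti * p))
  (Yp1 : 'M[R]_(q1, Td.+1 - (Ti + Tf)))
  (Yp2 : 'M[R]_(q2, Td.+1 - (Ti + Tf))) :
  let Up := past (hankel (Ti + Tf) ud) in
  let Uf := future (hankel (Ti + Tf) ud) in
  let Yp := past (hankel (Ti + Tf) yd) in
  let Yf := future (hankel (Ti + Tf) yd) in
  let Lambda := col_mx Up (col_mx Yp1 Uf) in
  controllable G -> observable G ->
  trajectory G ud yd ->
  persistently_exciting (Ti + Tf + n) ud ->
  is_lag G l -> (l <= Ti)%N ->
  negdef Phi22 ->
  (exists w, feasible G uini yini Phi11 Phi12 Phi22 w) ->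
  psd Q -> posdef Ru ->
  ker_basis Up M ->
  is_perm_mx PY -> PY *m Yp = castmx (Eq, erefl) (col_mx Yp1 Yp2) ->
  row_free Lambda ->
  \rank Lambda = \rank (col_mx Up (col_mx Yp Uf)) ->
  let Qbar := 1%:M *t Q : 'M[R]_(Tf * p) in
  let Rbar := 1%:M *t Ru : 'M[R]_(Tf * m) in
  let gini := Up^T *m invmx (Up *m Up^T) *m uini in
  let w0 := yini - Yp *m gini in
  let Aw := A_w Phi11 Phi12 Phi22 w0 (Yp *m M) in
  let Bini := B_ini Up Yp1 Uf Yf in
  let Bu := B_u Up Yp1 Uf Yf in
  let Bw := Bini *m M in
  let y0 := Bini *m gini in
  let costs (u : 'cV[R]_(Tf * m)) : set R :=
    [set lqte Q Ru r u (predicted_output Up Yp Uf Yf uini yini u w)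
      | w in [set w | feasible G uini yini Phi11 Phi12 Phi22 w]] in
  let worst u := sup (costs u) in
  let star (u : 'cV[R]_(Tf * m)) (gamma alpha : R) : Prop :=
    0 <= alpha /\ psd (lmi_mx Qbar Rbar Bu Bw y0 r Aw u gamma alpha) in
  let gammas u : set R := [set gamma | exists alpha, star u gamma alpha] in
  let all_gammas : set R :=
    [set gamma | exists u alpha, star u gamma alpha] in
  [/\ forall u, is_max (costs u) (worst u) /\ infimums (gammas u) (worst u),
      exists v, infimums (range worst) v /\ infimums all_gammas v
    & forall u, (forall u', worst u <= worst u') <->
        (exists v, infimums all_gammas v /\ infimums (gammas u) v)].
Proof.
move=> Up Uf Yp Yf Lambda ctrl _ trajd pe lag lTi Pneg [w1 [w1_traj w1_quad]] Qpsd Rpos.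
move=> Mbasis _ PYp Lfree rankL Qbar Rbar gini w0 Aw Bini Bu Bw y0 costs worst star.
move=> gammas all_gammas.
have Yf0 (g : 'cV_(Td.+1 - (Ti + Tf))) :
    Up *m g = 0 -> Yp *m g = 0 -> Uf *m g = 0 -> Yf *m g = 0.
  exact: future_output_eq0 trajd _ _ ctrl pe lag lTi.
have image_traj (g : 'cV_(Td.+1 - (Ti + Tf))) : trajectory G (Up *m g) (Yp *m g).
  exact: hankel_image_trajectory.
have traj_image y u : trajectory G uini y ->
    exists g, [/\ Up *m g = uini, Yp *m g = y & Uf *m g = u].
  exact: trajectory_hankel_image.
have change_input (g : 'cV_(Td.+1 - (Ti + Tf))) u :
    exists h, [/\ Up *m h = Up *m g, Yp *m h = Yp *m g & Uf *m h = u].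
  by apply: (trajectory_hankel_image trajd) => //; apply: image_traj.
have predicted := predicted_outputE Yf0 change_input PYp Lfree rankL.
(* [Up] is the top block of [Lambda], so it inherits full row rank. *)
have Upgini : Up *m gini = uini.
  rewrite /gini -/(rpinv Up) mulmxA mul_rpinv ?mul1mx //.
  exact: row_free_col_mxu Lfree.
have UpM : Up *m M = 0 by apply: ker_basis_mul0.
have Ypx x : Yp *m (gini + M *m x) = yini - (w0 - Yp *m M *m x).
  by rewrite mulmxDr (mulmxA _ M) /w0 -(addrA yini) -opprD subKr.
have Upx x : Up *m (gini + M *m x) = uini.
  by rewrite mulmxDr (mulmxA _ M) UpM mul0mx addr0.
(* A trajectory is the image of some [g] (the future input is taken to be 0), and such a [g] differs
   from [gini] by an element of the kernel of [Up]. *)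
have trajP w : trajectory G uini (yini - w) <-> exists x, w = w0 - Yp *m M *m x.
  split=> [/(traj_image _ 0)[g [ug yg _]]|[x ->]].
    have [x gx] := ker_basisP Mbasis (etrans ug (esym Upgini)).
    by exists x; move: yg; rewrite gx Ypx => /addrI/oppr_inj.
  by rewrite -Ypx -(Upx x); apply: image_traj.
have ker_Y (x : 'cV_d) : Yp *m M *m x = 0 -> Bw *m x = 0.
  rewrite /Bw -(mulmxA Bini) -(mulmxA Yp) => Yx.
  by apply: (B_ini_eq0 Yf0 change_input PYp Lfree rankL) => //; rewrite mulmxA UpM mul0mx.
pose cost := tracking_cost Qbar Rbar Bu Bw y0 r.
have lqte_cost u x :
    lqte Q Ru r u (predicted_output Up Yp Uf Yf uini yini u (w0 - Yp *m M *m x))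
    = cost u x.
  rewrite (predicted uini yini _ u _ (Upx x) (Ypx x)) lqteE /cost /tracking_cost.
  rewrite mulmxDr addrA (mulmxA _ M) -/Bini -/Bu -/Bw -/y0.
  by rewrite -!addrA [- r + _]addrC.
have [x1 w1E] : exists x, w1 = w0 - Yp *m M *m x by apply/trajP.
have exQ : exists x, 0 <= qform (block_mx Phi11 Phi12 Phi12^T Phi22)
    (col_mx 1%:M (w0 - Yp *m M *m x)) by exists x1; rewrite -w1E.
have core u := robust_tracking Bu y0 r
  Pneg (psd_tens1 Tf Qpsd) (posdef_tens1 Tf Rpos) ker_Y u exQ.
have worst_max u : is_max (costs u) (worst u) /\ infimums (gammas u) (worst u).
  have [x [x_feas x_max x_inf]] := core u.
  have maxx : is_max (costs u) (cost u x).
    split=> [|_ [w [w_traj w_quad] <-]].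
      exists (w0 - Yp *m M *m x); last exact: lqte_cost.
      by split=> //; apply/trajP; exists x.
    have [x' wE] := (proj1 (trajP w)) w_traj.
    by rewrite wE lqte_cost; apply: x_max; rewrite -wE.
  by rewrite /worst (is_max_sup maxx).
(* This lower bound ensures that the infimum over all inputs exists. *)
have worst_ge0 u : 0 <= worst u.
  have [[[w _ <-] _] _] := worst_max u.
  rewrite lqteE addr_ge0 //; first exact: (psd_tens1 Tf Qpsd).2.
  exact/posdef_ge0/posdef_tens1.
have [inf_eq opt_eq] := @inf_family R _ 0 gammas worst worst_ge0 (fun u => (worst_max u).2).
by split.
Qed.
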